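(* Let $d\ge 2$ and let $\Omega\subseteq\left[-\frac12,\frac12\right)^d$ be a measurable set. Assume there exist positive constants $\kappa_1,\beta_1$ and $v\in\Sigma_{d-1}$ such that for all sufficiently large $A$ and for every $\Theta\in\Sigma_{d-1}$, $$\frac1A\int_A^{2A}|\widehat{\chi_\Omega}(\rho\Theta)|^2\,d\rho\;\geq\;\begin{cases}\dfrac{\kappa_1}{A^{d+1}} & \text{if } |\Theta\cdot v|\le\beta_1,\\[2mm] \dfrac{\kappa_1}{A^{d+2}} & \text{if } \beta_1<|\Theta\cdot v|.\end{cases}$$ Then there exists a constant $c>0$ such that for every sufficiently large integer $N$ and every finite sequence of points $z_1,\dots,z_N\in\mathbb{T}^d$, $$\int_0^1\int_{\mathbb{T}^d}|D_N(x,t)|^2\,dx\,dt\;\ge\; c\,N^{1-\frac{d+1}{d^2+d-1}}.$$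
   Context: $\Sigma_{d-1}$ is the unit sphere of $\mathbb{R}^d$. The torus $\mathbb{T}^d=\mathbb{R}^d/\mathbb{Z}^d$ is identified with the unit cube $[-\frac12,\frac12)^d$. For a bounded measurable set $\Omega\subset\mathbb{R}^d$, $\widehat{\chi_\Omega}(\xi)=\int_\Omega e^{-2\pi i\xi\cdot x}\,dx$, and $|\Omega|$ is its Lebesgue measure. For a finite sequence $z_1,\dots,z_N\in\mathbb{T}^d$ (repetitions allowed), the discrepancy function is $$D_N(x,t)=\sum_{j=1}^N\chi_{-x+t\Omega}(z_j)-N\,t^d|\Omega|,\qquad (x,t)\in\mathbb{T}^d\times(0,1],$$ where $-x+t\Omega$ is regarded as a subset of $\mathbb{T}^d$, i.e. $\chi_{-x+t\Omega}(z)=1$ iff $z+x\in t\Omega$ modulo $\mathbb{Z}^d$. ''For all sufficiently large $A$ and every $\Theta$'' means the threshold on $A$ is independent of $\Theta$. *)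

(* Defs.v *)
From HB Require Import structures.
From mathcomp Require Import all_boot all_order all_algebra.
From mathcomp Require Import all_classical all_reals all_analysis.
From mathcomp Require Import complex.

Set Implicit Arguments.
Unset Strict Implicit.
Unset Printing Implicit Defensive.

Import Order.TTheory GRing.Theory Num.Theory.
Import numFieldNormedType.Exports.

Local Open Scope classical_set_scope.
Local Open Scope ring_scope.

Section Lebesgue.
Context {R : realType}.
Local Open Scope ereal_scope.

Local Notation borelR := (measurableTypeR R).

Definition tcons n (p : borelR * n.-tuple borelR) : n.+1.-tuple borelR :=
  [tuple of p.1 :: p.2].

Definition tuncons n (x : n.+1.-tuple borelR) : borelR * n.-tuple borelR :=
  (thead x, [tuple of behead x]).

Lemma measurable_tcons n : measurable_fun setT (@tcons n).
Proof. exact: measurable_cons. Qed.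

Lemma measurable_tuncons n : measurable_fun setT (@tuncons n).
Proof.
apply/measurable_fun_pairP; split => /=; first exact: measurable_tnth.
exact: measurable_behead.
Qed.

Section step.
Variables (n : nat) (mu : {sigma_finite_measure set (n.-tuple borelR) -> \bar R}).

Definition leb_step : set (n.+1.-tuple borelR) -> \bar R :=
  pushforward (lebesgue_measure \x mu) (@tcons n).

Let leb_step0 : leb_step set0 = 0.
Proof. by rewrite /leb_step /pushforward preimage_set0 measure0. Qed.

Let leb_step_ge0 A : 0 <= leb_step A.
Proof. exact: (measure_ge0 (lebesgue_measure \x mu)). Qed.

Let leb_step_sigma_additive : semi_sigma_additive leb_step.
Proof.
move=> F mF tF mUF; rewrite /leb_step /pushforward preimage_bigcup.
have mpre A : measurable A -> measurable (@tcons n @^-1` A).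
  by move=> mA; rewrite -[X in measurable X]setTI; exact: measurable_tcons.
apply: measure_semi_sigma_additive; first by move=> k; exact: mpre.
- apply/trivIsetP => i j _ _ ij; rewrite -preimage_setI.
  by move/trivIsetP : tF => /(_ _ _ I I ij) ->; rewrite preimage_set0.
- by rewrite -preimage_bigcup; exact: mpre.
Qed.

HB.instance Definition _ := isMeasure.Build _ _ _ leb_step
  leb_step0 leb_step_ge0 leb_step_sigma_additive.

Let leb_step_sigma_finite : sigma_finite setT leb_step.
Proof.
have /sigma_finiteP[F [FT ndF Foo]] := sigma_finiteT (@lebesgue_measure R).
have /sigma_finiteP[G [GT ndG Goo]] := sigma_finiteT mu.
exists (fun k => @tuncons n @^-1` (F k `*` G k)).
  apply/esym; rewrite -subTset => x _.
  have : (\bigcup_k F k) (thead x) by rewrite -FT.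
  have : (\bigcup_k G k) [tuple of behead x] by rewrite -GT.
  move=> [j _ Gx] [i _ Fx]; exists (maxn i j) => //; split => /=.
  - by move: Fx; apply/subsetPset/ndF/leq_maxl.
  - by move: Gx; apply/subsetPset/ndG/leq_maxr.
move=> k; have [mF Fk] := Foo k; have [mG Gk] := Goo k; split.
  rewrite -[X in measurable X]setTI; apply: measurable_tuncons => //.
  exact: measurableX.
rewrite /leb_step /pushforward -comp_preimage.
have -> : @tuncons n \o @tcons n = id.
  by apply/funext => -[a t] /=; congr pair; exact/val_inj.
by rewrite preimage_id product_measure1E// lte_mul_pinfty// ge0_fin_numE.
Qed.

HB.instance Definition _ := Measure_isSigmaFinite.Build _ _ _ leb_step
  leb_step_sigma_finite.

End step.

(* The n-fold product of Lebesgue measure, on the Borel sets of R^n; tuples are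
   identified with iterated pairs through tcons. *)
Fixpoint borel_leb d : {sigma_finite_measure set (d.-tuple borelR) -> \bar R} :=
  if d is n.+1 then leb_step (borel_leb n) else dirac [tuple].


Lemma measurable_box d (A : 'I_d -> set R) :
  (forall i, measurable (A i : set borelR)) ->
  measurable [set x : d.-tuple borelR | forall i, A i (tnth x i)].
Proof.
move=> mA; rewrite [X in measurable X](_ : _ =
    \bigcap_(i in [set: 'I_d]) (@tnth _ borelR ^~ i) @^-1` (A i)).
  apply: fin_bigcap_measurable => // i _.
  by rewrite -[X in measurable X]setTI; exact: measurable_tnth.
by apply/seteqP; split=> x /= h i; [move=> _|]; exact: h.
Qed.

Lemma borel_leb_prod d (A : 'I_d -> set R) :
  (forall i, measurable (A i : set borelR)) ->
  borel_leb d [set x | forall i, A i (tnth x i)] =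
  \prod_(i < d) lebesgue_measure (A i).
Proof.
elim: d A => [|d IH] A mA.
  by rewrite big_ord0 /= diracE mem_set//= => -[].
rewrite big_ord_recl -IH//.
have mB := @measurable_box d (fun i => A (lift ord0 i)) (fun i => mA _).
rewrite -product_measure1E// /= /leb_step /pushforward; congr (_ _).
apply/seteqP; split=> -[r x] /=.
  by move=> h; split; [exact: (h ord0)|move=> i; move: (h (lift ord0 i)); rewrite tnthS].
move=> [hr hx] i; case: (unliftP ord0 i) => [j|] ->; last exact: hr.
by rewrite tnthS; have := hx j; congr (A _ (tnth _ _)); exact/val_inj.
Qed.

(* R^d with its Lebesgue sigma-algebra: "measurable" for a subset of euclid d
   means Caratheodory-measurable for the outer measure of borel_leb d, so that
   lebesgue d is complete. *)
Definition euclid d := caratheodory_type (borel_leb d)^*%mu.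

Definition lebesgue d : {measure set (euclid d) -> \bar R} :=
  @completed_measure_extension _ _ _ (borel_leb d).

Lemma lebesgue_prod d (A : 'I_d -> set R) :
  (forall i, measurable (A i : set borelR)) ->
  lebesgue d [set x | forall i, A i (tnth x i)] =
  \prod_(i < d) lebesgue_measure (A i).
Proof.
move=> mA; rewrite -borel_leb_prod//.
by apply: (measurable_mu_extE (borel_leb d)); exact: measurable_box.
Qed.

End Lebesgue.

Arguments euclid : clear implicits.
Arguments lebesgue : clear implicits.

Section Vectors.
Context {R : realType} {d : nat}.
Implicit Types (x y : euclid R d) (A : set (euclid R d)).

Definition dotp x y : R := \sum_(i < d) tnth x i * tnth y i.

Definition sphere : set (euclid R d) := [set x | Num.sqrt (dotp x x) = 1].

Definition addv x y : euclid R d := [tuple tnth x i + tnth y i | i < d].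

Definition scalev (t : R) x : euclid R d := [tuple t * tnth x i | i < d].

Definition dilate (t : R) A : set (euclid R d) := scalev t @` A.

(* The fundamental domain with which the torus R^d / Z^d is identified *)
Definition cube : set (euclid R d) :=
  [set x | forall i, - 2^-1 <= tnth x i < 2^-1].

Definition intv (k : d.-tuple int) : euclid R d := [tuple (tnth k i)%:~R | i < d].

(* - x + A as a subset of the torus: z belongs to it iff z + x is in A modulo
   Z^d. *)
Definition torus_translate x A : set (euclid R d) :=
  [set z | exists k : d.-tuple int, A (addv (addv z x) (intv k))].

End Vectors.

Section Fourier.
Context {R : realType}.

(* e^(iu) *)
Definition expi (u : R) : R[i] := Complex (cos u) (sin u).

Definition cintegral d (T : measurableType d) (mu : {measure set T -> \bar R})
    (D : set T) (f : T -> R[i]) : R[i] :=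
  Complex (\int[mu]_(x in D) complex.Re (f x))
          (\int[mu]_(x in D) complex.Im (f x)).

Definition fourier_indic d (W : set (euclid R d)) (xi : euclid R d) : R[i] :=
  cintegral (lebesgue R d) W (fun x => expi (- (2 * pi * dotp xi x))).

End Fourier.

Definition discrepancy (R : realType) (d : nat) (W : set (euclid R d)) (N : nat)
    (z : 'I_N -> euclid R d) (x : euclid R d) (t : R) : R :=
  \sum_(j < N) \1_(torus_translate x (dilate t W)) (z j)
  - N%:R * t ^+ d * fine (lebesgue R d W).

(* Main.v *)
Require Import Defs.
From mathcomp Require Import all_boot all_order all_algebra.
From mathcomp Require Import all_classical all_reals all_analysis.
From mathcomp Require Import complex.
From mathcomp Require Import measurable_realfun.
From mathcomp Require Import ring lra zify.

(** Fix N points z_1, ..., z_N and put S(n) = sum_j e(n.z_j) for n in Z^d, where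
e(u) = exp(2 pi i u).  For n <> 0 the n-th Fourier coefficient of x |-> D_N(x, t)
has squared modulus |S(n)|^2 t^(2d) |F(tn)|^2, where F is the Fourier transform
of the indicator of Omega.  Bessel's inequality ([bessel],
[le_integral_discrepancy]) and integration over t in [1/2, 1]
([le_dilation_average]) bound the discrepancy from below by a constant times
sum_n w(n) |S(n)|^2, over any finite set of nonzero frequencies, where by the
hypothesis on Omega ([le_average_sqr_fourier]) w(n) is at least of order
|n|^-(d+2) for all large n, and of order |n|^-(d+1) if moreover
|n.v| <= beta1 |n|.  It remains to show that such a weighted sum D of the |S(n)|^2
cannot be small.

The vector v need not be rational.  The frequencies are therefore restricted to
a sublattice of Z^d ([lattice_point]) spanned by one coordinate vector e_i with
v_i <> 0 and by d - 1 long integer vectors that are almost orthogonal to v.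
Seen in the coordinates nu of that lattice, the points z_j become other points
[dual_point] of R^d, |n| is comparable to the sup norm of nu, and
|n.v| <= beta1 |n| holds as soon as |nu_i| is at most some other |nu_j|
([off_axis_lattice_point]).

Let Q(a, b) be the sum of |S(mu - mu')|^2 over all pairs mu, mu' of integer points
of the box that has side a in the direction i and side b in the other directions.
Since Q(a, b) is a sum over pairs (k, l) of products of Fejer kernels evaluated at
z_k - z_l ([tent_mass_fejer]), its diagonal gives Q(a, b) >= N (a b^(d-1))^2
([tent_mass_ge]), and doubling a side multiplies it by at most 4
([le_tent_mass_double]).  The gain comes from doubling the sides in the d - 1
directions other than i ([mass_step]).  A frequency with |nu_j| < a for all j <> i
then gains no more than the number of points of the box does, up to a factor
1 + O(a/b); every other frequency of the box satisfies |nu_i| < a <= |nu_j| for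
some j, so it carries the larger weight, and all of these together contribute at
most O(D b^(d+1)) per point of the box.

Start from a = Y, b = 2^J Y, where the cube of side Y contributes at most
O(N^2) + D Y^(d+2), and alternately double the transversal side and quadruple the
axial one until a = b = X = 4^J Y.  Because b/a = 2^j at the j-th step from the
end, the relative losses 1 + O(2^-j) have a bounded product, and because
d + 1 > 2 the errors D b^(d+1) add up to O(D X^(d+1)).  Hence
N X^d <= C ((X/Y) N^2 + D (X Y^(d+1) + X^(d+1))) ([anisotropic_count]).
For X of order N^((d+1)/e) and Y of order N^(d/e), where e = d^2 + d - 1, both
terms multiplying D have order X^(d+1), and X^(d-1) Y exceeds a large
multiple of N, so that the N^2 term is absorbed by the left-hand side.  This leaves
D >= c N/X ([bound_from_count]), which is the assertion. *)

Set Implicit Arguments.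
Unset Strict Implicit.
Unset Printing Implicit Defensive.

Import Order.TTheory GRing.Theory Num.Theory.
Import numFieldNormedType.Exports.
Import ComplexField.Normc.

Local Open Scope classical_set_scope.
Local Open Scope ring_scope.

(** * Lebesgue measure on the line and product maps *)

Definition image_measure d1 d2 (T1 : measurableType d1) (T2 : measurableType d2)
    (R : realType) (mu : {measure set T1 -> \bar R}) (f : T1 -> T2)
    (mf : measurable_fun setT f) : {measure set T2 -> \bar R} :=
  measure_function_pushforward__canonical__measure_function_Measure mu mf.

Section line.
Context {R : realType}.
Local Notation borelR := (measurableTypeR R).
Local Notation leb := (@lebesgue_measure R).

Lemma lebesgue_measure_shift (a : R) (A : set borelR) : measurable A ->
  leb ((fun x : borelR => x + a) @^-1` A) = leb A.
Proof.
move=> mA.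
have mf : measurable_fun [set: borelR] (fun x : borelR => (x + a : borelR)).
  by apply: measurable_funD => //; exact: measurable_cst.
pose m := image_measure leb mf.
apply/esym; rewrite -[RHS]/(m A); apply: lebesgue_measure_unique => //= _ [[u v]] _ <-.
rewrite /pushforward.
have -> : (fun x : borelR => x + a) @^-1` `]u, v] = `]u - a, v - a]%classic.
  by apply/seteqP; split=> x /=; rewrite !in_itv/= ltrBlDr lerBrDr.
rewrite !lebesgue_measure_itv/= !lte_fin ltrD2r.
by case: ifPn => // _; rewrite -!EFinB; congr EFin; ring.
Qed.

Lemma lebesgue_measure_scale (t : R) (A : set borelR) : 0 < t -> measurable A ->
  leb ((fun x : borelR => t * x) @^-1` A) = (t^-1%:E * leb A)%E.
Proof.
move=> t0 mA.
have mf : measurable_fun [set: borelR] (fun x : borelR => (t * x : borelR)).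
  by apply: measurable_funM => //; exact: measurable_cst.
pose m := image_measure leb mf.
pose tn : {nonneg R} := NngNum (ltW t0).
suff : leb A = mscale tn m A.
  rewrite /mscale /= => ->; rewrite muleA -EFinM mulVf ?gt_eqF//.
  by rewrite mul1e.
apply: lebesgue_measure_unique => //= _ [[u v]] _ <-.
rewrite /mscale/= /pushforward.
have -> : (fun x : borelR => t * x) @^-1` `]u, v] = `]u / t, v / t]%classic.
  apply/seteqP; split=> x /=; rewrite !in_itv/= ltr_pdivrMr// ler_pdivlMr//;
  by rewrite [x * t]mulrC.
rewrite !lebesgue_measure_itv/= !lte_fin ltr_pM2r ?invr_gt0//.
case: ifPn => // _; last by rewrite mule0.
rewrite -!EFinB -EFinM; congr EFin; field; exact: lt0r_neq0.
Qed.

End line.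

Section product_map.
Context {R : realType} {d : nat}.
Local Notation borelR := (measurableTypeR R).
Local Notation leb := (@lebesgue_measure R).
Local Notation mu := (borel_leb (R:=R) d).
Implicit Types phi psi : 'I_d -> borelR -> borelR.

Definition coordmap phi (x : d.-tuple borelR) : d.-tuple borelR :=
  [tuple phi i (tnth x i) | i < d].

Lemma measurable_coordmap phi : (forall i, measurable_fun setT (phi i)) ->
  measurable_fun setT (coordmap phi).
Proof.
move=> mphi; apply/measurable_fun_tnthP => i.
rewrite (_ : _ \o _ = phi i \o (fun x => tnth x i)); last first.
  by apply/funext => x; rewrite /= tnth_mktuple.
exact: measurableT_comp (measurable_tnth i).
Qed.

Definition box (A : 'I_d -> set borelR) : set (d.-tuple borelR) :=
  [set x | forall i, A i (tnth x i)].

Definition boxes : set (set (d.-tuple borelR)) :=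
  [set B | exists2 A, (forall i, measurable (A i)) & B = box A].

Lemma measurable_boxes : @measurable _ (d.-tuple borelR) = <<s boxes >>.
Proof.
apply/seteqP; split.
- apply: smallest_sub; first exact: smallest_sigma_algebra.
  move=> B /=; rewrite -bigcup_seq /= => -[i _ [A mA <-]].
  apply: sub_sigma_algebra.
  exists (fun j => if j == i then A else setT).
    by move=> j; case: ifP => // _; exact: measurableT.
  apply/seteqP; split=> x /=.
    by move=> [_ Ax] j; case: ifPn => // /eqP ->.
  by move=> /(_ i); rewrite eqxx; split.
- apply: smallest_sub; first exact: sigma_algebra_measurable.
  by move=> _ [A mA ->]; exact: measurable_box.
Qed.

Lemma boxes_setI : setI_closed boxes.
Proof.
move=> _ _ [A mA ->] [B mB ->]; exists (fun i => A i `&` B i).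
  by move=> i; exact: measurableI.
apply/seteqP; split=> x /=; first by move=> [hA hB] i; split.
by move=> h; split=> i; case: (h i).
Qed.

(** Both sides are measures in B that agree on boxes by the product formula, and
boxes form a pi-system generating the Borel sets. *)
Lemma borel_leb_coordmap phi (c : R) (B : set (d.-tuple borelR)) :
  0 < c -> (forall i, measurable_fun setT (phi i)) ->
  (forall i A, measurable A -> leb (phi i @^-1` A) = (c%:E * leb A)%E) ->
  measurable B ->
  mu (coordmap phi @^-1` B) = ((c ^+ d)%:E * mu B)%E.
Proof.
move=> c0 mphi hphi mB.
pose m1 := image_measure mu (measurable_coordmap mphi).
have cd0 : 0 <= c ^+ d by rewrite exprn_ge0// ltW.
pose m2 := mscale (NngNum cd0) mu.
have eqbox A : (forall i, measurable (A i)) -> m1 (box A) = m2 (box A).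
  move=> mA; rewrite /m1 /m2 /= /pushforward /mscale /=.
  have -> : coordmap phi @^-1` box A = box (fun i => phi i @^-1` A i).
    by apply/seteqP; split=> x /= h i; have := h i; rewrite tnth_mktuple.
  rewrite /box !borel_leb_prod//.
  rewrite (@borel_leb_prod _ _ (fun i => phi i @^-1` A i)); last first.
    by move=> i; rewrite -[X in measurable X]setTI; exact: (mphi i).
  under eq_bigr do rewrite hphi//.
  by rewrite big_split/= prodEFin prodr_const card_ord.
apply: (@measure_unique _ _ _ boxes (fun k => box (fun=> `]- k%:R, k%:R[%classic))
   measurable_boxes boxes_setI _ _ m1 m2) => //.
- move=> k; exists (fun=> `]- k%:R, k%:R[%classic) => // i; exact: measurable_itv.
- rewrite -subTset => x _.
  pose M := \sum_(i < d) `|tnth x i|.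
  have M0 : 0 <= M by apply: sumr_ge0.
  exists (Num.truncn M).+1 => // i /=; rewrite in_itv/= -ltr_norml.
  apply: le_lt_trans (truncnS_gt M).
  rewrite /M (bigD1 i)//= lerDl; exact: sumr_ge0.
- by move=> _ [A mA ->]; exact: eqbox.
- move=> k; rewrite eqbox; last by move=> i; exact: measurable_itv.
  rewrite /m2 /mscale /= /box.
  rewrite (@borel_leb_prod _ _ (fun=> `]- k%:R, k%:R[%classic)); last first.
    by move=> i; exact: measurable_itv.
  under eq_bigr do rewrite lebesgue_measure_itv/=.
  case: ifPn => _; rewrite ?prod_EFin.
    by rewrite -EFinB prodEFin -EFinM ltry.
  by rewrite prodEFin -EFinM ltry.
Qed.

End product_map.

(** * Maps that scale the completed measure *)

Section completion.
Context {R : realType} {d : nat}.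
Local Notation borelR := (measurableTypeR R).
Local Notation mu := (borel_leb (R:=R) d).
Local Notation leb := (lebesgue R d).
Implicit Types F G : euclid R d -> euclid R d.

(** The inverse image of a cover by Borel sets is again such a cover, so the
Borel inequality passes to the outer measure of arbitrary sets. *)
Lemma lebesgue_preimage_le F (c : R) (X : set (euclid R d)) : 0 < c ->
  measurable_fun [set: d.-tuple borelR] (F : d.-tuple borelR -> d.-tuple borelR) ->
  (forall B : set (d.-tuple borelR), measurable B ->
     mu (F @^-1` B) = (c%:E * mu B)%E) ->
  (leb (F @^-1` X) <= c%:E * leb X)%E.
Proof.
move=> c0 mF hF.
rewrite -lee_pdivrMl//.
apply: le_ereal_inf_tmp => _ [A [mA XA] <-].
rewrite lee_pdivrMl//.
rewrite -nneseriesZl; last by move=> k _; exact: measure_ge0.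
apply: ereal_inf_lbound.
exists (fun k => F @^-1` (A k)).
  split=> [k|x /XA [k _ Ak]]; last by exists k.
  by rewrite -[X in measurable X]setTI; apply: mF => //; exact: mA.
by apply: eq_eseriesr => k _; rewrite /= hF//; exact: mA.
Qed.

(** X ranges over arbitrary sets, on which the completed measure is the outer measure;
for invertible F this yields measurability for the completed sigma-algebra. *)
Definition scales (k : R) F :=
  0 < k /\ forall X : set (euclid R d), leb (F @^-1` X) = (k%:E * leb X)%E.

(** The reverse inequality is [lebesgue_preimage_le] for the inverse map. *)
Lemma scales_borel F G (c : R) : 0 < c -> cancel F G -> cancel G F ->
  measurable_fun [set: d.-tuple borelR] (F : d.-tuple borelR -> d.-tuple borelR) ->
  measurable_fun [set: d.-tuple borelR] (G : d.-tuple borelR -> d.-tuple borelR) ->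
  (forall B : set (d.-tuple borelR), measurable B ->
     mu (F @^-1` B) = (c%:E * mu B)%E) ->
  scales c F.
Proof.
move=> c0 FG GF mF mG hF; split=> // X.
apply/eqP; rewrite eq_le; apply/andP; split; first exact: lebesgue_preimage_le.
have GFX Y : F @^-1` (G @^-1` Y) = Y.
  by rewrite -comp_preimage (_ : G \o F = id) ?preimage_id//; apply/funext.
have FGX Y : G @^-1` (F @^-1` Y) = Y.
  by rewrite -comp_preimage (_ : F \o G = id) ?preimage_id//; apply/funext.
rewrite -{1}(FGX X) -lee_pdivlMl//; apply: lebesgue_preimage_le => //.
  by rewrite invr_gt0.
move=> B mB; rewrite -[in RHS](GFX B) hF; last first.
  by rewrite -[X in measurable X]setTI; exact: mG.
by rewrite muleA -EFinM mulVf ?gt_eqF// mul1e.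
Qed.

(** Caratheodory's criterion for the inverse image of A, tested on X, is k times the
criterion for A, tested on the image of X. *)
Lemma scales_measurable k F G : cancel F G -> cancel G F ->
  scales k F -> measurable_fun setT F.
Proof.
move=> FG GF [k0 hF] _ A mA; rewrite setTI.
have {}mA : caratheodory_measurable (mu^*)%mu A by [].
suff : caratheodory_measurable (mu^*)%mu (F @^-1` A) by [].
move=> X; have GFX : F @^-1` (G @^-1` X) = X.
  by rewrite -comp_preimage (_ : G \o F = id) ?preimage_id//; apply/funext.
rewrite -GFX preimage_setC -!preimage_setI.
have hF' Y : (mu^* (F @^-1` Y))%mu = (k%:E * (mu^* Y)%mu)%E by exact: hF.
rewrite !hF' [in LHS]mA.
by rewrite ge0_muleDr//; exact: outer_measure_ge0.
Qed.

Lemma ge0_integral_scales k F (D : set (euclid R d)) (f : euclid R d -> \bar R) :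
  scales k F -> measurable_fun setT F ->
  measurable D -> measurable_fun D f -> (forall y, 0 <= f y)%E ->
  (\int[leb]_(x in F @^-1` D) f (F x) = k%:E * \int[leb]_(y in D) f y)%E.
Proof.
move=> [k0 hF] mF mD mf f0.
rewrite -[LHS](ge0_integral_pushforward mF leb mD mf)//.
have -> : k = (NngNum (ltW k0))%:num by [].
rewrite -ge0_integral_mscale//.
by apply: eq_measure_integral => A mA _; exact: hF.
Qed.

Lemma Rintegral_scales k F (D : set (euclid R d)) (f : euclid R d -> R) :
  scales k F -> measurable_fun setT F -> measurable D ->
  leb.-integrable D (EFin \o f) ->
  \int[leb]_(x in F @^-1` D) f (F x) = k * \int[leb]_(y in D) f y.
Proof.
move=> kF mF mD intf; rewrite /Rintegral.
have mf : measurable_fun D (EFin \o f) by case/integrableP : intf.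
have Efin : (\int[leb]_(x in F @^-1` D) (f (F x))%:E =
    k%:E * \int[leb]_(y in D) (f y)%:E)%E.
  rewrite [LHS]integralE [in RHS]integralE.
  rewrite muleBr//; last first.
    rewrite fin_num_adde_defl// fin_numN; exact: (integrable_neg_fin_num mD intf).
  rewrite -(@ge0_integral_scales k F D (EFin \o f)^\+%E)//; last first.
    exact: measurable_funepos.
  rewrite -(@ge0_integral_scales k F D (EFin \o f)^\-%E)//; last first.
    exact: measurable_funeneg.
  by congr (_ - _)%E; apply: eq_integral => x _; rewrite ?funeposE ?funenegE.
by rewrite Efin fineM//; exact: integrable_fin_num.
Qed.

End completion.

(** * Rotations of the circle as bijections of the line *)

Section rotation.
Context {R : realType}.
Local Notation borelR := (measurableTypeR R).
Local Notation leb := (@lebesgue_measure R).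

(** The interval exchange of [-1/2, 1/2) that represents the rotation by s. Being
the identity elsewhere, it is a bijection of R that preserves Lebesgue measure, so
that products of such maps need no restriction to the cube. *)
Definition circle_rot (s x : R) : R :=
  if - 2^-1 <= x < 2^-1 then (if x < 2^-1 - s then x + s else x + s - 1) else x.

Implicit Types s x : R.

Lemma circle_rotK s : 0 <= s <= 1 -> cancel (circle_rot s) (circle_rot (1 - s)).
Proof.
move=> s01 x; rewrite /circle_rot.
have [xI|xI] /= := boolP (- 2^-1 <= x < 2^-1); last by rewrite (negbTE xI).
have [xs|xs] /= := ltP x (2^-1 - s).
  have -> : - 2^-1 <= x + s < 2^-1 by lra.
  by case: ifPn => y2; lra.
have -> : - 2^-1 <= x + s - 1 < 2^-1 by lra.
by case: ifPn => y2; lra.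
Qed.

Lemma circle_rot_itv s x : 0 <= s <= 1 ->
  (- 2^-1 <= circle_rot s x < 2^-1) = (- 2^-1 <= x < 2^-1).
Proof.
move=> s01; rewrite /circle_rot.
have [xI|xI] := boolP (- 2^-1 <= x < 2^-1); last exact/negbTE.
by have [xs|xs] := ltP x (2^-1 - s); lra.
Qed.

Lemma measure_split (P Q B : set borelR) :
  measurable P -> measurable Q -> measurable B -> P `&` Q = set0 ->
  leb B = (leb (B `&` P) + (leb (B `&` Q) + leb (B `\` (P `|` Q))))%E.
Proof.
move=> mP mQ mB PQ.
rewrite -measureU; last 3 first.
- exact: measurableI.
- by apply: measurableD => //; exact: measurableU.
- by apply/seteqP; split=> // x /= [[_ Qx] [_]]; apply; right.
rewrite -measureU; last 3 first.
- exact: measurableI.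
- by apply: measurableU; [exact: measurableI|apply: measurableD => //; exact: measurableU].
- apply/seteqP; split=> // x /= [[_ Px] [[_ Qx]|[_]]]; last by apply; left.
  by have : (P `&` Q) x by []; rewrite PQ.
congr (leb _); apply/seteqP; split=> x /=; last by case=> [[]|[[]|[]]].
move=> Bx; have [Px|nPx] := pselect (P x); first by left.
right; have [Qx|nQx] := pselect (Q x); first by left.
by right; split=> // -[].
Qed.

Let piece1 (s : R) : set borelR := `[- 2^-1, 2^-1 - s[%classic.
Let piece2 (s : R) : set borelR := `[2^-1 - s, 2^-1[%classic.

(** On each of the two intervals it exchanges, the rotation is a translation. *)
Let rot_piece1 s (A : set borelR) : 0 <= s <= 1 ->
  circle_rot s @^-1` A `&` piece1 s =
  (+%R^~ s : borelR -> borelR) @^-1` (A `&` piece2 (1 - s)).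
Proof.
move=> s01; apply/seteqP; split=> x; rewrite /piece1 /piece2 /= !in_itv/= /circle_rot.
  move=> [+ /andP[x1 x2]]; rewrite x1 x2 (lt_le_trans x2) /=; last lra.
  by move=> Ax; split => //; lra.
move=> [Ax x12]; have -> /= : - 2^-1 <= x < 2^-1 by lra.
have -> : x < 2^-1 - s by lra.
by split=> //; lra.
Qed.

Let rot_piece2 s (A : set borelR) : 0 <= s <= 1 ->
  circle_rot s @^-1` A `&` piece2 s =
  (+%R^~ (s - 1) : borelR -> borelR) @^-1` (A `&` piece1 (1 - s)).
Proof.
move=> s01; apply/seteqP; split=> x; rewrite /piece1 /piece2 /= !in_itv/= /circle_rot.
  move=> [+ x12]; have -> /= : - 2^-1 <= x < 2^-1 by lra.
  have -> : (x < 2^-1 - s) = false by lra.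
  by rewrite addrA => Ax; split => //; lra.
move=> [Ax x12]; have -> /= : - 2^-1 <= x < 2^-1 by lra.
have -> : (x < 2^-1 - s) = false by lra.
by rewrite -addrA; split=> //; lra.
Qed.

Let pieceU s : 0 <= s <= 1 -> piece1 s `|` piece2 s = `[- 2^-1, 2^-1[%classic.
Proof.
move=> s01; apply/seteqP; split=> x; rewrite /piece1 /piece2 /= !in_itv/=.
  by case=> ?; lra.
by move=> x12; have [?|?] := ltP x (2^-1 - s); [left|right]; lra.
Qed.

Let pieceI s : piece1 s `&` piece2 s = set0.
Proof. by apply/seteqP; split=> // x; rewrite /piece1 /piece2 /= !in_itv/= => -[]; lra. Qed.

Let rot_piece3 s (A : set borelR) :
  circle_rot s @^-1` A `\` `[- 2^-1, 2^-1[ = A `\` `[- 2^-1, 2^-1[.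
Proof.
by apply/seteqP; split=> x /=; rewrite !in_itv/= /circle_rot => -[+ /negP xI];
  rewrite (negbTE xI).
Qed.

Let measurable_shift (a : R) : measurable_fun [set: borelR] (+%R^~ a : borelR -> borelR).
Proof. by apply: measurable_funD => //; exact: measurable_cst. Qed.

Lemma measurable_circle_rot s : 0 <= s <= 1 ->
  measurable_fun [set: borelR] (circle_rot s : borelR -> borelR).
Proof.
move=> s01 _ A mA; rewrite setTI.
rewrite (_ : _ @^-1` _ = (circle_rot s @^-1` A `&` piece1 s) `|`
  ((circle_rot s @^-1` A `&` piece2 s) `|` (circle_rot s @^-1` A `\` `[- 2^-1, 2^-1[))).
  rewrite rot_piece1// rot_piece2// rot_piece3.
  apply: measurableU; last apply: measurableU; last exact: measurableD.
    rewrite -[X in measurable X]setTI; apply: measurable_shift => //.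
    by apply: measurableI => //; exact: measurable_itv.
  rewrite -[X in measurable X]setTI; apply: measurable_shift => //.
  by apply: measurableI => //; exact: measurable_itv.
rewrite -(pieceU s01); apply/seteqP; split=> x /=; last by case=> [[]|[[]|[]]].
move=> Bx; have [Px|nPx] := pselect (piece1 s x); first by left.
right; have [Qx|nQx] := pselect (piece2 s x); first by left.
by right; split=> // -[].
Qed.

Lemma lebesgue_measure_circle_rot s (A : set borelR) : 0 <= s <= 1 -> measurable A ->
  leb (circle_rot s @^-1` A) = leb A.
Proof.
move=> s01 mA.
have s01' : 0 <= 1 - s <= 1 by lra.
have mp1 t : measurable (piece1 t) by exact: measurable_itv.
have mp2 t : measurable (piece2 t) by exact: measurable_itv.
have mB : measurable (circle_rot s @^-1` A).
  by rewrite -[X in measurable X]setTI; exact: measurable_circle_rot.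
rewrite (measure_split (mp1 s) (mp2 s) mB (pieceI s)).
rewrite [RHS](measure_split (mp1 (1 - s)) (mp2 (1 - s)) mA (pieceI _)).
rewrite !pieceU// rot_piece1// rot_piece2// rot_piece3.
rewrite !lebesgue_measure_shift//; [|exact: measurableI..].
by rewrite addeCA.
Qed.

End rotation.

(** * Dilations and torus translations *)

Section space.
Context {R : realType} {d : nat}.
Local Notation borelR := (measurableTypeR R).
Local Notation leb := (lebesgue R d).
Local Notation E := (euclid R d).
Implicit Types (x y z xi : E) (k n : d.-tuple int) (t : R).

Lemma measurable_euclid_borel d' (T : measurableType d') (f : E -> T) :
  measurable_fun [set: d.-tuple borelR] (f : d.-tuple borelR -> T) ->
  measurable_fun [set: E] f.
Proof.
move=> mf _ A mA; apply: caratheodory_measurable_mu_ext; exact: mf.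
Qed.

Lemma measurable_euclid_set (A : set (d.-tuple borelR)) :
  measurable A -> measurable (A : set E).
Proof. exact: caratheodory_measurable_mu_ext. Qed.

Let cubeE : @cube R d = [set x | forall i, (`[- 2^-1, 2^-1[%classic : set R) (tnth x i)].
Proof. by apply/seteqP; split=> x /= h i; have := h i; rewrite in_itv/=. Qed.

Lemma measurable_cube : measurable (@cube R d).
Proof.
rewrite cubeE; apply: measurable_euclid_set.
by apply: (@measurable_box _ _ (fun=> `[- 2^-1, 2^-1[%classic)) => i; exact: measurable_itv.
Qed.

Lemma lebesgue_cube : leb cube = 1%E.
Proof.
rewrite cubeE (@lebesgue_prod _ _ (fun=> `[- 2^-1, 2^-1[%classic)); last first.
  by move=> i; exact: measurable_itv.
rewrite big1// => i _; rewrite lebesgue_measure_itv/= lte_fin.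
by rewrite ifT; [rewrite -EFinB; congr EFin; lra|lra].
Qed.

Lemma integrable_bounded (D : set E) (f : E -> R) (M : R) : measurable D ->
  D `<=` cube -> measurable_fun D f -> (forall x, D x -> `|f x| <= M) ->
  leb.-integrable D (EFin \o f).
Proof.
move=> mD Dc mf fM; apply: measurable_bounded_integrable => //.
  apply: (@le_lt_trans _ _ (leb cube)); last by rewrite lebesgue_cube ltry.
  by apply: le_measure; rewrite ?inE//; exact: measurable_cube.
exists M; split; first exact: num_real.
by move=> y My x Dx; apply: le_trans (fM _ Dx) _; exact: ltW.
Qed.

Lemma measurable_dotp xi : measurable_fun [set: E] (dotp xi).
Proof.
apply: measurable_euclid_borel; apply: measurable_sum => i.
by apply: measurable_funM; [exact: measurable_cst|exact: measurable_tnth].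
Qed.

Lemma scalevK t : t != 0 -> cancel (@scalev R d t) (scalev t^-1).
Proof.
move=> t0 x; apply: eq_from_tnth => i.
by rewrite !tnth_mktuple mulrA mulVf// mul1r.
Qed.

Lemma scales_scalev t : 0 < t -> scales (t^-1 ^+ d) (@scalev R d t).
Proof.
move=> t0.
have mt (u : R) : measurable_fun [set: borelR] (fun x : borelR => (u * x : borelR)).
  by apply: measurable_funM => //; exact: measurable_cst.
apply: (@scales_borel _ _ _ (scalev t^-1)).
- by rewrite exprn_gt0// invr_gt0.
- by apply: scalevK; rewrite gt_eqF.
- by rewrite -{2}(invrK t); apply: scalevK; rewrite invr_eq0 gt_eqF.
- exact: (@measurable_coordmap _ _ (fun=> ( *%R t))).
- exact: (@measurable_coordmap _ _ (fun=> ( *%R t^-1))).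
- move=> B mB; apply: (@borel_leb_coordmap _ _ (fun=> ( *%R t))) => //.
    by rewrite invr_gt0.
  by move=> _ A mA; exact: lebesgue_measure_scale.
Qed.

Lemma measurable_scalev t : 0 < t -> measurable_fun setT (@scalev R d t).
Proof.
move=> t0; apply: (@scales_measurable _ _ (t^-1 ^+ d) _ (scalev t^-1)).
- by apply: scalevK; rewrite gt_eqF.
- by rewrite -{2}(invrK t); apply: scalevK; rewrite invr_eq0 gt_eqF.
- exact: scales_scalev.
Qed.

(** Translation of the torus, as a bijection of R^d that preserves the cube. *)
Definition torus_rot (s : 'I_d -> R) (x : E) : E := coordmap (fun i => circle_rot (s i)) x.

Lemma torus_rotK s : (forall i, 0 <= s i <= 1) ->
  cancel (torus_rot s) (torus_rot (fun i => 1 - s i)).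
Proof.
move=> s01 x; apply: eq_from_tnth => i.
by rewrite /torus_rot !tnth_mktuple circle_rotK.
Qed.

Lemma scales_torus_rot s : (forall i, 0 <= s i <= 1) -> scales 1 (torus_rot s).
Proof.
move=> s01; have s01' i : 0 <= 1 - s i <= 1 by have := s01 i; lra.
apply: (@scales_borel _ _ _ (torus_rot (fun i => 1 - s i))) => //.
- exact: torus_rotK.
- rewrite (_ : s = fun i => 1 - (1 - s i)); last by apply/funext => i; lra.
  move=> x; rewrite -[in RHS](@torus_rotK (fun i => 1 - s i) _ x)//.
  by congr (torus_rot _ (torus_rot _ _)); apply/funext => i; lra.
- by apply: measurable_coordmap => i; exact: measurable_circle_rot.
- by apply: measurable_coordmap => i; exact: measurable_circle_rot.
- move=> B mB; rewrite -(expr1n R d).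
  apply: (@borel_leb_coordmap _ _ (fun i => circle_rot (s i))) => //.
    by move=> i; exact: measurable_circle_rot.
  by move=> i A mA; rewrite mul1e lebesgue_measure_circle_rot.
Qed.

Lemma measurable_torus_rot s : (forall i, 0 <= s i <= 1) ->
  measurable_fun setT (torus_rot s).
Proof.
move=> s01; have s01' i : 0 <= 1 - s i <= 1 by have := s01 i; lra.
apply: (@scales_measurable _ _ 1 _ (torus_rot (fun i => 1 - s i))).
- exact: torus_rotK.
- have := torus_rotK s01'; rewrite (_ : (fun i => 1 - (1 - s i)) = s)//.
  by apply/funext => i; lra.
- exact: scales_torus_rot.
Qed.

Lemma torus_shift z : cube z -> exists F : E -> E,
  [/\ scales 1 F, measurable_fun setT F, F @^-1` cube = cube &
     forall x, cube x -> exists k, F x = Defs.addv (Defs.addv x z) (intv k)].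
Proof.
move=> cz.
pose s i := if 0 <= tnth z i then tnth z i else tnth z i + 1.
have s01 i : 0 <= s i <= 1.
  by rewrite /s; have := cz i; case: ifPn => ? ?; lra.
exists (torus_rot s); split.
- exact: scales_torus_rot.
- exact: measurable_torus_rot.
- by apply/seteqP; split=> x /= h i; have := h i; rewrite tnth_mktuple circle_rot_itv.
move=> x cx.
pose kk i : int := if 0 <= tnth z i then
  (if tnth x i < 2^-1 - s i then 0 else -1) else
  (if tnth x i < 2^-1 - s i then 1 else 0).
exists [tuple kk i | i < d].
apply: eq_from_tnth => i; rewrite !tnth_mktuple /circle_rot.
have -> : - 2^-1 <= tnth x i < 2^-1 by exact: cx.
rewrite /kk /s; case: (boolP (0 <= tnth z i)) => z0 /=; case: ltP => /= xs;
  rewrite ?mulr0z ?mulr1z ?mulrN1z; lra.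
Qed.

(** The integral over the torus of a periodic function does not depend on the
origin: f is g translated by z, where only the values of g on the cube matter. *)
Lemma Rintegral_torus_shift z (f g : E -> R) : cube z ->
  leb.-integrable cube (EFin \o g) ->
  (forall x k, cube x -> cube (Defs.addv (Defs.addv x z) (intv k)) ->
     f x = g (Defs.addv (Defs.addv x z) (intv k))) ->
  \int[leb]_(x in cube) f x = \int[leb]_(x in cube) g x.
Proof.
move=> cz intg fg; have [F [F1 mF Fc FE]] := torus_shift cz.
rewrite -[RHS]mul1r -(Rintegral_scales F1 mF measurable_cube intg) Fc.
apply: eq_Rintegral => x /set_mem cx; have [k Fx] := FE x cx.
by rewrite Fx; apply: fg => //; rewrite -Fx -[cube _]/((F @^-1` cube) x) Fc.
Qed.

End space.

(** * Characters on the unit cube *)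

Section characters.
Context {R : realType} {d : nat}.
Local Notation leb := (lebesgue R d).
Local Notation E := (euclid R d).
Local Notation I f := (\int[leb]_(x in cube) f x).
Implicit Types (x y z xi : E) (k n : d.-tuple int) (t : R) (f g : E -> R).

Definition phase n x : R := 2 * pi * dotp (intv n) x.

Lemma dotpDr xi x y : dotp xi (Defs.addv x y) = dotp xi x + dotp xi y.
Proof.
rewrite /dotp -big_split; apply: eq_bigr => i _ /=.
by rewrite tnth_mktuple mulrDr.
Qed.

Lemma phaseD n x y : phase n (Defs.addv x y) = phase n x + phase n y.
Proof. by rewrite /phase dotpDr mulrDr. Qed.

(** Integer multiples of the period are built in, because the phases of two points
that differ by an element of Z^d differ by such a multiple. *)
Definition periodic_2pi (g : R -> R) := forall u (m : int), g (u + 2 * pi * m%:~R) = g u.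

Lemma periodic_2piP (g : R -> R) :
  (forall u, g (u + pi *+ 2) = g u) -> periodic_2pi g.
Proof.
move=> gp u [m|m].
  rewrite (_ : _ * _ = pi *+ 2 *+ m); first exact: periodicn.
  by rewrite -[2 * pi]mulrC mulr_natr pmulrn mulr_natr.
rewrite -[in RHS](subrK (pi *+ 2 *+ m.+1) u) periodicn//; congr (g (_ + _)).
by rewrite NegzE mulrNz mulrN -pmulrn mulr_natr [2 * pi]mulrC mulr_natr.
Qed.

Lemma circle_cos : periodic_2pi (@cos R).
Proof. exact/periodic_2piP/cosD2pi. Qed.

Lemma circle_sin : periodic_2pi (@sin R).
Proof. exact/periodic_2piP/sinD2pi. Qed.

Lemma dotp_intv n k : dotp (@intv R d n) (intv k) =
  (\sum_(i < d) tnth n i * tnth k i)%:~R.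
Proof.
rewrite /dotp [RHS](raddf_sum (@intmul R 1)); apply: eq_bigr => i _.
by rewrite !tnth_mktuple /= intrM.
Qed.

Lemma phase_intv (g : R -> R) n x k u : periodic_2pi g ->
  g (phase n (Defs.addv x (intv k)) + u) = g (phase n x + u).
Proof. by move=> gp; rewrite phaseD /phase dotp_intv addrAC; exact: gp. Qed.

Definition bdmeas f := measurable_fun cube f /\ exists M : R, forall x, cube x -> `|f x| <= M.

Lemma bdmeas_integrable f : bdmeas f -> leb.-integrable cube (EFin \o f).
Proof.
move=> [mf [M fM]]; apply: (@integrable_bounded _ _ _ _ M) => //.
exact: measurable_cube.
Qed.

Lemma bdmeas_cst (c : R) : bdmeas (cst c).
Proof. by split; [exact: measurable_cst|exists `|c|]. Qed.

Lemma bdmeasD f g : bdmeas f -> bdmeas g -> bdmeas (fun x => f x + g x).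
Proof.
move=> [mf [M fM]] [mg [M' gM]]; split; first exact: measurable_funD.
by exists (M + M') => x cx; rewrite (le_trans (ler_normD _ _))// lerD ?fM ?gM.
Qed.

Lemma bdmeasM f g : bdmeas f -> bdmeas g -> bdmeas (fun x => f x * g x).
Proof.
move=> [mf [M fM]] [mg [M' gM]]; split; first exact: measurable_funM.
by exists (M * M') => x cx; rewrite normrM ler_pM ?fM ?gM.
Qed.

Lemma bdmeas_sum (J : Type) (r : seq J) (P : pred J) (F : J -> E -> R) :
  (forall j, bdmeas (F j)) ->
  bdmeas (fun x => \sum_(j <- r | P j) F j x).
Proof.
move=> bF; elim: r => [|j r IH].
  by under [X in bdmeas X]eq_fun do rewrite big_nil; exact: bdmeas_cst.
under [X in bdmeas X]eq_fun do rewrite big_cons.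
by case: (P j); [exact: bdmeasD (bF j) IH|exact: IH].
Qed.

Lemma bdmeas_phase (g : R -> R) n (u : R) : continuous g -> (forall v, `|g v| <= 1) ->
  bdmeas (fun x => g (phase n x + u)).
Proof.
move=> cg g1; split; last by exists 1 => x _; exact: g1.
apply: measurable_funTS.
apply: (measurableT_comp (continuous_measurable_fun cg)).
exact: measurable_funD (measurable_funM (measurable_cst _) (measurable_dotp _))
  (measurable_cst _).
Qed.

Lemma RintegralD_cube f g : bdmeas f -> bdmeas g -> I (fun x => f x + g x) = I f + I g.
Proof. by move=> bf bg; rewrite RintegralD//; [exact: measurable_cube|exact: bdmeas_integrable..]. Qed.

Lemma RintegralZl_cube (c : R) f : bdmeas f -> I (fun x => c * f x) = c * I f.
Proof. by move=> bf; rewrite RintegralZl//; [exact: measurable_cube|exact: bdmeas_integrable]. Qed.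

Lemma Rintegral_cst_cube (c : R) : I (fun=> c) = c.
Proof.
rewrite Rintegral_cst; last exact: measurable_cube.
by rewrite lebesgue_cube mulr1.
Qed.

Lemma Rintegral_sum_cube (J : Type) (r : seq J) (P : pred J) (F : J -> E -> R) :
  (forall j, bdmeas (F j)) ->
  I (fun x => \sum_(j <- r | P j) F j x) = \sum_(j <- r | P j) I (F j).
Proof.
move=> bF; elim: r => [|j r IH].
  by under eq_Rintegral do rewrite big_nil; rewrite Rintegral_cst_cube big_nil.
under eq_Rintegral do rewrite big_cons.
rewrite big_cons; case: (P j); last exact: IH.
by rewrite (RintegralD_cube (bF j) (bdmeas_sum r P bF)) IH.
Qed.

Lemma le_Rintegral_cube f g : bdmeas f -> bdmeas g ->
  (forall x, cube x -> f x <= g x) -> I f <= I g.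
Proof.
move=> bf bg fg; apply: le_Rintegral => //; [exact: measurable_cube|exact: bdmeas_integrable..].
Qed.

(** A nontrivial character has mean zero: some translation z of the torus changes
its sign. Stated for g because cosine and sine are treated alike. *)
Lemma Rintegral_phase_eq0 (g : R -> R) n (u : R) :
  (forall v, g (v - pi) = - g v) -> (forall v, g (v + pi) = - g v) ->
  periodic_2pi g -> continuous g ->
  (forall v, `|g v| <= 1) -> (exists i, tnth n i != 0) ->
  I (fun x => g (phase n x + u)) = 0.
Proof.
move=> gNpi gpi gp cg g1 [i ni0].
(* a half-period in the direction i; the minus sign puts z into the half-open cube *)
pose z : E := [tuple (if j == i then - (2 * `|tnth n i|%:~R)^-1 else 0) | j < d].
have n1 : 1 <= `|tnth n i|%:~R :> R.
  by rewrite -[1]/(1%:~R) ler_int -gtz0_ge1 normr_gt0.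
have cz : cube z.
  move=> j; rewrite tnth_mktuple; case: ifP => _; last lra.
  have v0 : 0 < (2 * `|tnth n i|%:~R)^-1 :> R by rewrite invr_gt0; lra.
  have v1 : (2 * `|tnth n i|%:~R)^-1 <= 2^-1 :> R by rewrite lef_pV2 ?posrE//; lra.
  lra.
have zE : phase n z = - pi * (Num.sg (tnth n i))%:~R.
  rewrite /phase /dotp (bigD1 i)//= big1 ?addr0; last first.
    by move=> j ji; rewrite !tnth_mktuple (negbTE ji) mulr0.
  rewrite !tnth_mktuple eqxx.
  rewrite -[in X in _ * (X%:~R * _)](mulr_sg_norm (tnth n i)) intrM.
  by field; rewrite gt_eqF//; lra.
have gE v : g (v + phase n z) = - g v.
  rewrite zE; case: (sgrP (tnth n i)) ni0 => //= _ _; rewrite ?mulr1 ?mulrN1z ?mulrNN ?mulr1 //.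
have bg := bdmeas_phase n u cg g1.
have : I (fun x => -1 * g (phase n x + u)) = I (fun x => g (phase n x + u)).
  apply: (Rintegral_torus_shift cz (bdmeas_integrable bg)) => x k _ _.
  by rewrite phase_intv// phaseD addrAC gE mulN1r.
by rewrite RintegralZl_cube//; lra.
Qed.

Lemma Rintegral_cos_eq0 n (u : R) : (exists i, tnth n i != 0) ->
  I (fun x => cos (phase n x + u)) = 0.
Proof.
apply: Rintegral_phase_eq0;
  [|exact: cosDpi|exact: circle_cos|exact: continuous_cos|exact: cos_max].
by move=> v; rewrite -[in RHS](subrK pi v) cosDpi opprK.
Qed.

Lemma Rintegral_sin_eq0 n (u : R) : (exists i, tnth n i != 0) ->
  I (fun x => sin (phase n x + u)) = 0.
Proof.
apply: Rintegral_phase_eq0;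
  [|exact: sinDpi|exact: circle_sin|exact: continuous_sin|exact: sin_max].
by move=> v; rewrite -[in RHS](subrK pi v) sinDpi opprK.
Qed.

Lemma bdmeas_cos n (u : R) : bdmeas (fun x => cos (phase n x + u)).
Proof. by apply: bdmeas_phase; [exact: continuous_cos|exact: cos_max]. Qed.

Lemma bdmeas_sin n (u : R) : bdmeas (fun x => sin (phase n x + u)).
Proof. by apply: bdmeas_phase; [exact: continuous_sin|exact: sin_max]. Qed.

End characters.

(** * Fourier coefficients of the discrepancy *)

Section bessel.
Context {R : realType} {d : nat}.
Local Notation leb := (lebesgue R d).
Local Notation E := (euclid R d).
Local Notation I f := (\int[leb]_(x in cube) f x).
Implicit Types (x y z xi : E) (k : d.-tuple int) (t : R) (f g : E -> R).

Lemma phaseB (m n : d.-tuple int) x :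
  phase m x - phase n x = phase [tuple tnth m i - tnth n i | i < d] x.
Proof.
rewrite /phase -mulrBr /dotp -sumrB; congr (_ * _); apply: eq_bigr => i _.
by rewrite !tnth_mktuple intrB mulrBl.
Qed.

Definition cos_coef f (n : d.-tuple int) := I (fun x => f x * cos (phase n x)).

Definition sin_coef f (n : d.-tuple int) := I (fun x => f x * sin (phase n x)).

(** With c_n = a_n - i b_n and h = sum_n c_n e_n, the inequality |f - h|^2 >= 0 reads
f^2 >= 2 f Re h - |h|^2; the right-hand side has integral sum_n |c_n|^2 by
orthogonality, [h] and [h'] below being the real and imaginary parts of h. *)
Lemma bessel (F : finType) (n : F -> d.-tuple int) f : injective n -> bdmeas f ->
  \sum_j (cos_coef f (n j) ^+ 2 + sin_coef f (n j) ^+ 2) <= I (fun x => f x ^+ 2).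
Proof.
move=> n_inj bf; pose a j := cos_coef f (n j); pose b j := sin_coef f (n j).
have aE j : I (fun x => f x * cos (phase (n j) x)) = a j by [].
have bE j : I (fun x => f x * sin (phase (n j) x)) = b j by [].
rewrite -[X in X <= _]/(\sum_j (a j ^+ 2 + b j ^+ 2)).
move: a b aE bE => a b aE bE.
have bc j : bdmeas (fun x => cos (phase (n j) x)).
  by have := @bdmeas_cos R d (n j) 0; under [X in bdmeas X]eq_fun do rewrite addr0.
have bs j : bdmeas (fun x => sin (phase (n j) x)).
  by have := @bdmeas_sin R d (n j) 0; under [X in bdmeas X]eq_fun do rewrite addr0.
pose S := \sum_j (a j ^+ 2 + b j ^+ 2).
pose h x := \sum_j (a j * cos (phase (n j) x) + b j * sin (phase (n j) x)).
pose h' x := \sum_j (a j * sin (phase (n j) x) - b j * cos (phase (n j) x)).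
pose N x := \sum_i \sum_j ((a i * a j + b i * b j) * cos (phase (n i) x - phase (n j) x)
  + (b i * a j - a i * b j) * sin (phase (n i) x - phase (n j) x)).
have hN x : h x ^+ 2 + h' x ^+ 2 = N x.
  rewrite !expr2 /h /h' !mulr_suml -big_split; apply: eq_bigr => i _ /=.
  rewrite !mulr_sumr -big_split; apply: eq_bigr => j _ /=.
  by rewrite cosB sinB; ring.
have bCd i j : bdmeas (fun x => (a i * a j + b i * b j) * cos (phase (n i) x - phase (n j) x)).
  apply: (bdmeasM (bdmeas_cst _)).
  under [X in bdmeas X]eq_fun do rewrite phaseB -[phase _ _]addr0; exact: bdmeas_cos.
have bSd i j : bdmeas (fun x => (b i * a j - a i * b j) * sin (phase (n i) x - phase (n j) x)).
  apply: (bdmeasM (bdmeas_cst _)).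
  under [X in bdmeas X]eq_fun do rewrite phaseB -[phase _ _]addr0; exact: bdmeas_sin.
have bN : bdmeas N by do 2 apply: bdmeas_sum => ?; exact: bdmeasD.
have bh : bdmeas h.
  by apply: bdmeas_sum => j; apply: bdmeasD; apply: (bdmeasM (bdmeas_cst _)).
have IN : I N = S.
  rewrite Rintegral_sum_cube; last by move=> i; apply: bdmeas_sum => j; exact: bdmeasD.
  apply: eq_bigr => i _; rewrite Rintegral_sum_cube; last by move=> j; exact: bdmeasD.
  rewrite (bigD1 i)//= [X in _ + X]big1 ?addr0.
    under eq_Rintegral do rewrite subrr cos0 sin0 mulr1 mulr0 addr0.
    by rewrite Rintegral_cst_cube -!expr2.
  move=> j ji; rewrite RintegralD_cube//.
  under eq_Rintegral do rewrite phaseB -[phase _ _]addr0.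
  under [X in _ + X]eq_Rintegral do rewrite phaseB -[phase _ _]addr0.
  have ex : exists l, tnth [tuple tnth (n i) l0 - tnth (n j) l0 | l0 < d] l != 0.
    have : n i != n j by apply: contra_neq ji => /n_inj.
    move/eqP => nij; apply/existsP; apply: contra_notT nij.
    rewrite negb_exists => /forallP nij; apply: eq_from_tnth => l.
    by have := nij l; rewrite negbK tnth_mktuple subr_eq0 => /eqP.
  rewrite !RintegralZl_cube; [|exact: bdmeas_sin|exact: bdmeas_cos].
  by rewrite Rintegral_cos_eq0// Rintegral_sin_eq0// !mulr0 addr0.
have Ifh : I (fun x => f x * h x) = S.
  under eq_Rintegral do rewrite mulr_sumr.
  rewrite Rintegral_sum_cube; last first.
    by move=> j; apply: (bdmeasM bf); apply: bdmeasD; apply: (bdmeasM (bdmeas_cst _)).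
  apply: eq_bigr => j _.
  under eq_Rintegral do rewrite mulrDr mulrCA [X in _ + X]mulrCA.
  have bfc := bdmeasM bf (bc j); have bfs := bdmeasM bf (bs j).
  rewrite (RintegralD_cube (bdmeasM (bdmeas_cst _) bfc) (bdmeasM (bdmeas_cst _) bfs)).
  rewrite (RintegralZl_cube _ bfc) (RintegralZl_cube _ bfs).
  by rewrite aE bE.
have bfh := bdmeasM bf bh.
have : I (fun x => 2 * (f x * h x) + -1 * N x) <= I (fun x => f x ^+ 2).
  apply: le_Rintegral_cube.
  - exact: bdmeasD (bdmeasM (bdmeas_cst _) bfh) (bdmeasM (bdmeas_cst _) bN).
  - by under [X in bdmeas X]eq_fun do rewrite expr2; exact: bdmeasM.
  - move=> x _; rewrite -hN -subr_ge0.
    have -> : f x ^+ 2 - (2 * (f x * h x) + -1 * (h x ^+ 2 + h' x ^+ 2)) =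
      (f x - h x) ^+ 2 + h' x ^+ 2 by ring.
    by rewrite addr_ge0// sqr_ge0.
rewrite (RintegralD_cube (bdmeasM (bdmeas_cst 2) bfh) (bdmeasM (bdmeas_cst (-1)) bN)).
rewrite (RintegralZl_cube 2 bfh) (RintegralZl_cube (-1) bN).
by rewrite IN Ifh -/S; lra.
Qed.

End bessel.

Section linear_phase.
Context {R : realType} {d : nat}.
Local Notation E := (euclid R d).
Implicit Types (x y z xi : E) (n : d.-tuple int) (t : R).

Lemma dotpZl t xi y : dotp (scalev t xi) y = t * dotp xi y.
Proof.
by rewrite /dotp mulr_sumr; apply: eq_bigr => i _; rewrite tnth_mktuple mulrA.
Qed.

Lemma dotpZr t xi y : dotp xi (scalev t y) = t * dotp xi y.
Proof.
by rewrite /dotp mulr_sumr; apply: eq_bigr => i _; rewrite tnth_mktuple mulrCA.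
Qed.

Lemma phase_scalev n t y : phase n (scalev t y) = t * phase n y.
Proof. by rewrite /phase dotpZr mulrCA. Qed.

Lemma measurable_phase_scalev n t u :
  measurable_fun [set: E] (fun y => phase n (scalev t y) + u).
Proof.
under eq_fun do rewrite phase_scalev.
exact: measurable_funD (measurable_funM (measurable_cst _)
  (measurable_funM (measurable_cst _) (measurable_dotp _))) (measurable_cst _).
Qed.

End linear_phase.

Section coefficients.
Context {R : realType} {d : nat}.
Local Notation leb := (lebesgue R d).
Local Notation E := (euclid R d).
Local Notation I f := (\int[leb]_(x in cube) f x).
Implicit Types (x y z xi : E) (k n : d.-tuple int) (t : R) (f g : E -> R).
Variables (W : set E) (mW : measurable W) (Wc : W `<=` cube).

Lemma dilateE t (A : set E) : 0 < t -> dilate t A = scalev t^-1 @^-1` A.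
Proof.
move=> t0; apply/seteqP; split=> x /=.
  by move=> [y Ay <-]; rewrite scalevK// gt_eqF.
move=> Ax; exists (scalev t^-1 x) => //.
by rewrite -{1}(invrK t) scalevK// invr_eq0 gt_eqF.
Qed.

Lemma measurable_dilate t : 0 < t -> measurable (dilate t W).
Proof.
move=> t0; rewrite dilateE// -[X in measurable X]setTI.
by apply: measurable_scalev; rewrite ?invr_gt0.
Qed.

Lemma dilate_cube t : 0 < t <= 1 -> dilate t W `<=` cube.
Proof.
move=> /andP[t0 t1] _ [x Wx <-] i; rewrite tnth_mktuple.
have /andP[x1 x2] := Wc Wx i; apply/andP; split; nra.
Qed.

Lemma Rintegral_dilate t f : 0 < t -> leb.-integrable (dilate t W) (EFin \o f) ->
  \int[leb]_(y in dilate t W) f y = t ^+ d * \int[leb]_(y in W) f (scalev t y).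
Proof.
move=> t0 intf.
have := Rintegral_scales (scales_scalev t0) (measurable_scalev t0) (measurable_dilate t0) intf.
have -> : scalev t @^-1` dilate t W = W.
  rewrite dilateE// -comp_preimage (_ : _ \o _ = id) ?preimage_id//.
  by apply/funext => x /=; rewrite scalevK// gt_eqF.
by move=> ->; rewrite mulrA -exprMn divff ?gt_eqF// expr1n mul1r.
Qed.

(** Two points of the half-open cube that differ by an integer vector coincide. *)
Lemma cube_shift0 x k : cube x -> cube (Defs.addv x (intv k)) -> Defs.addv x (intv k) = x.
Proof.
move=> cx cxk; apply: eq_from_tnth => i; have := cxk i; rewrite !tnth_mktuple.
have /andP[x1 x2] := cx i => /andP[y1 y2].
have k1 : (tnth k i)%:~R < 1%:~R :> R by lra.
have k2 : (-1)%:~R < (tnth k i)%:~R :> R by lra.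
move: k1 k2; rewrite !ltr_int => k1 k2.
have -> : tnth k i = 0 by lia.
by rewrite addr0.
Qed.

Lemma cube_translate z A x k : A `<=` cube ->
  cube (Defs.addv (Defs.addv x z) (intv k)) ->
  torus_translate x A z <-> A (Defs.addv (Defs.addv x z) (intv k)).
Proof.
move=> Ac ck; split=> [[k' Ak']|Ak]; last first.
  exists k; congr A: Ak; apply: eq_from_tnth => i.
  by rewrite !tnth_mktuple [tnth z i + _]addrC.
pose k'' := [tuple tnth k' i - tnth k i | i < d].
have E' : Defs.addv (Defs.addv z x) (intv k') =
    Defs.addv (Defs.addv (Defs.addv x z) (intv k)) (intv k'').
  by apply: eq_from_tnth => i; rewrite !tnth_mktuple intrB; ring.
by move: (Ak'); rewrite E' cube_shift0//; rewrite -E'; exact: Ac.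
Qed.

Lemma bdmeas_indicM (A : set E) f : measurable A -> bdmeas f -> bdmeas (fun x => \1_A x * f x).
Proof.
move=> mA bf; apply: bdmeasM => //; split; first exact: measurable_funTS.
by exists 1 => x _; rewrite indicE ger0_norm//; case: (_ \in _).
Qed.

Lemma Rintegral_indicM (A : set E) f : A `<=` cube ->
  I (fun x => \1_A x * f x) = \int[leb]_(x in A) f x.
Proof.
move=> Ac; have {2}-> : A = cube `&` A.
  by apply/seteqP; split=> x; [split=> //; exact: Ac|case].
rewrite Rintegral_mkcondr.
apply: eq_Rintegral => x _; rewrite patchE indicE.
by case: (x \in A); rewrite ?mul1r ?mul0r.
Qed.

(** Translating the torus by z moves the indicator of the dilate of W, read modulo
Z^d, to the indicator of the dilate itself, which lies in the cube; a change of
variables then brings the integral back to W. *)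
Lemma translate_coef (g : R -> R) t z n : 0 < t <= 1 -> cube z ->
  periodic_2pi g -> continuous g -> (forall v, `|g v| <= 1) ->
  I (fun x => \1_(torus_translate x (dilate t W)) z * g (phase n x)) =
  t ^+ d * \int[leb]_(y in W) g (phase n (scalev t y) - phase n z).
Proof.
move=> t01 cz gp cg g1; have t0 : 0 < t by case/andP: t01.
have mtW := measurable_dilate t0; have tWc := dilate_cube t01.
have bg := bdmeas_phase n (- phase n z) cg g1.
rewrite -(@Rintegral_dilate t (fun y => g (phase n y - phase n z)))//; last first.
  by apply: integrableS (bdmeas_integrable bg) => //; exact: measurable_cube.
rewrite -(Rintegral_indicM _ tWc).
apply: (Rintegral_torus_shift cz).
  by apply: bdmeas_integrable; exact: bdmeas_indicM.
move=> x k cx ck; rewrite phase_intv// phaseD addrK; congr (_ * _).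
by rewrite !indicE; congr (_ %:R); congr nat_of_bool; apply/idP/idP;
  rewrite !inE => /(cube_translate tWc ck).
Qed.

Definition cosW t n := \int[leb]_(y in W) cos (phase n (scalev t y)).
Definition sinW t n := \int[leb]_(y in W) sin (phase n (scalev t y)).

Let intW (g : R -> R) n t u : continuous g -> (forall v, `|g v| <= 1) ->
  leb.-integrable W (EFin \o (fun y => g (phase n (scalev t y) + u))).
Proof.
move=> cg g1; apply: (integrable_bounded mW Wc (M := 1)); last first.
  by move=> y _; exact: g1.
apply: measurable_funTS; apply: measurableT_comp (measurable_phase_scalev n t u).
exact: continuous_measurable_fun.
Qed.

Lemma bdmeas_translate t z : 0 < t <= 1 -> cube z ->
  bdmeas (fun x => \1_(torus_translate x (dilate t W)) z : R).
Proof.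
move=> t01 cz; have t0 : 0 < t by case/andP: t01.
have mtW := measurable_dilate t0; have tWc := dilate_cube t01.
split; last by exists 1 => x _; rewrite indicE ger0_norm//; case: (_ \in _).
have [F [F1 mF Fc FE]] := torus_shift cz.
have mg : measurable_fun cube (fun x => \1_(dilate t W) (F x) : R).
  apply: measurable_funTS; apply: (measurableT_comp _ mF).
  exact: measurable_indic.
apply: eq_measurable_fun mg => x /set_mem cx; have [k Fx] := FE x cx.
have ck : cube (Defs.addv (Defs.addv x z) (intv k)).
  by rewrite -Fx -[cube _]/((F @^-1` cube) x) Fc.
rewrite !indicE; congr (_ %:R); congr nat_of_bool.
by apply/idP/idP; rewrite !inE Fx => /(cube_translate tWc ck).
Qed.

Lemma integrable_cosW n t :
  leb.-integrable W (EFin \o (fun y => cos (phase n (scalev t y)))).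
Proof.
rewrite (_ : (fun y => _) = fun y => cos (phase n (scalev t y) + 0)).
  by apply: intW => //; [exact: continuous_cos|exact: cos_max].
by apply/funext => y; rewrite addr0.
Qed.

Lemma integrable_sinW n t :
  leb.-integrable W (EFin \o (fun y => sin (phase n (scalev t y)))).
Proof.
rewrite (_ : (fun y => _) = fun y => sin (phase n (scalev t y) + 0)).
  by apply: intW => //; [exact: continuous_sin|exact: sin_max].
by apply/funext => y; rewrite addr0.
Qed.

Lemma integrable_mulr f (c : R) : leb.-integrable W (EFin \o f) ->
  leb.-integrable W (EFin \o (fun y => f y * c)).
Proof. by move=> intf; exact: (integrableZr mW c intf). Qed.

Section discr.
Variables (N : nat) (z : 'I_N -> E) (cz : forall j, cube (z j)).

Definition cos_sum n := \sum_j cos (phase n (z j)).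
Definition sin_sum n := \sum_j sin (phase n (z j)).

Local Notation D t := (fun x => discrepancy W z x t).

Lemma bdmeas_discrepancy t : 0 < t <= 1 -> bdmeas (D t).
Proof.
move=> t01; apply: bdmeasD; last exact: bdmeas_cst.
by apply: bdmeas_sum => j; exact: bdmeas_translate.
Qed.

Lemma discrepancy_coef (g : R -> R) t n : 0 < t <= 1 ->
  (forall v, g (v - pi) = - g v) -> (forall v, g (v + pi) = - g v) ->
  periodic_2pi g -> continuous g -> (forall v, `|g v| <= 1) ->
  (exists i, tnth n i != 0) ->
  I (fun x => D t x * g (phase n x)) =
  t ^+ d * \sum_j \int[leb]_(y in W) g (phase n (scalev t y) - phase n (z j)).
Proof.
move=> t01 gNpi gpi gp cg g1 n0.
have bg : bdmeas (fun x => g (phase n x)).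
  by have := bdmeas_phase n 0 cg g1; under [X in bdmeas X]eq_fun do rewrite addr0.
pose c := - (N%:R * t ^+ d * fine (leb W)).
rewrite (_ : (fun x => _) = (fun x =>
    \sum_j (\1_(torus_translate x (dilate t W)) (z j) * g (phase n x)) +
    c * g (phase n x))); last first.
  by apply/funext => x; rewrite /discrepancy mulrDl mulr_suml.
have b1 j : bdmeas (fun x => \1_(torus_translate x (dilate t W)) (z j) * g (phase n x)).
  exact: bdmeasM (bdmeas_translate t01 (cz j)) bg.
have I0 : I (fun x => g (phase n x)) = 0.
  under eq_Rintegral do rewrite -[phase n _]addr0.
  exact: Rintegral_phase_eq0.
rewrite (RintegralD_cube (bdmeas_sum _ _ b1) (bdmeasM (bdmeas_cst c) bg)).
rewrite (RintegralZl_cube c bg) I0 mulr0 addr0 (Rintegral_sum_cube _ _ b1).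
rewrite mulr_sumr; apply: eq_bigr => j _.
exact: translate_coef.
Qed.

Lemma cos_coef_discrepancy t n : 0 < t <= 1 -> (exists i, tnth n i != 0) ->
  cos_coef (D t) n = t ^+ d * (cosW t n * cos_sum n + sinW t n * sin_sum n).
Proof.
move=> t01 n0.
rewrite /cos_coef (discrepancy_coef t01 _ (@cosDpi R) (@circle_cos R)
  (@continuous_cos R) (@cos_max R) n0); last first.
  by move=> v; rewrite -[in RHS](subrK pi v) cosDpi opprK.
congr (_ * _); rewrite /cos_sum /sin_sum !mulr_sumr -big_split; apply: eq_bigr => j _ /=.
under eq_Rintegral do rewrite cosB.
rewrite (RintegralD mW (integrable_mulr _ (integrable_cosW n t))
  (integrable_mulr _ (integrable_sinW n t))).
by rewrite (RintegralZr _ mW (integrable_cosW n t)) (RintegralZr _ mW (integrable_sinW n t)).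
Qed.

Lemma sin_coef_discrepancy t n : 0 < t <= 1 -> (exists i, tnth n i != 0) ->
  sin_coef (D t) n = t ^+ d * (sinW t n * cos_sum n - cosW t n * sin_sum n).
Proof.
move=> t01 n0.
rewrite /sin_coef (discrepancy_coef t01 _ (@sinDpi R) (@circle_sin R)
  (@continuous_sin R) (@sin_max R) n0); last first.
  by move=> v; rewrite -[in RHS](subrK pi v) sinDpi opprK.
congr (_ * _); rewrite /cos_sum /sin_sum !mulr_sumr -sumrB; apply: eq_bigr => j _ /=.
under eq_Rintegral do rewrite sinB.
rewrite (RintegralB mW (integrable_mulr _ (integrable_sinW n t))
  (integrable_mulr _ (integrable_cosW n t))).
by rewrite (RintegralZr _ mW (integrable_sinW n t)) (RintegralZr _ mW (integrable_cosW n t)).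
Qed.

(** The Fourier coefficient at n is t^d times the product of the exponential sum
over the points and the transform of W at tn; both are expanded into real and
imaginary parts. *)
Lemma le_integral_discrepancy (F : finType) (n : F -> d.-tuple int) t :
  injective n -> (forall j, exists i, tnth (n j) i != 0) -> 0 < t <= 1 ->
  ((\sum_j (cos_sum (n j) ^+ 2 + sin_sum (n j) ^+ 2) *
     (t ^+ (2 * d) * (cosW t (n j) ^+ 2 + sinW t (n j) ^+ 2)))%:E <=
   \int[leb]_(x in cube) (`|discrepancy W z x t| ^+ 2)%:E)%E.
Proof.
move=> n_inj n0 t01.
have bD := bdmeas_discrepancy t01.
have bD2 : bdmeas (fun x => D t x ^+ 2).
  by under [X in bdmeas X]eq_fun do rewrite expr2; exact: bdmeasM.
have -> : (\int[leb]_(x in cube) (`|discrepancy W z x t| ^+ 2)%:E =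
    (I (fun x => D t x ^+ 2))%:E)%E.
  rewrite fineK; last first.
    by apply: integrable_fin_num; [exact: measurable_cube|exact: bdmeas_integrable bD2].
  by apply: eq_integral => x _; rewrite real_normK// num_real.
rewrite lee_fin; apply: le_trans (bessel n_inj bD).
apply: ler_sum => j _; rewrite cos_coef_discrepancy// sin_coef_discrepancy//.
rewrite mulnC exprM le_eqVlt; apply/orP; left; apply/eqP; ring.
Qed.

End discr.
End coefficients.

(** * Averaging over dilations *)

(** A simple function below f is below g, for arbitrary integrands. It is used with g
the integral over the torus as a function of the dilation. *)
Lemma ge0_le_integral_nonmeasurable d (T : measurableType d) (R : realType)
    (mu : {measure set T -> \bar R}) (D : set T) (f g : T -> \bar R) :
  (forall x, D x -> 0 <= f x)%E -> (forall x, D x -> f x <= g x)%E ->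
  (\int[mu]_(x in D) f x <= \int[mu]_(x in D) g x)%E.
Proof.
move=> f0 fg; have g0 x : D x -> (0 <= g x)%E.
  by move=> Dx; exact: le_trans (f0 _ Dx) (fg _ Dx).
rewrite !ge0_integralE//; apply: le_ereal_sup => _ [h hf <-]; exists h => //= x.
apply: le_trans (hf x) _; rewrite !patchE; case: ifPn => // /set_mem; exact: fg.
Qed.

Lemma ge0_integral_scale1 (R : realType) (r : R) (D : set R) (f : R -> \bar R) :
  0 < r -> measurable D -> measurable_fun D f -> (forall x, 0 <= f x)%E ->
  (\int[lebesgue_measure]_(t in (fun t => r * t)%R @^-1` D) f (r * t)%R =
   r^-1%:E * \int[lebesgue_measure]_(x in D) f x)%E.
Proof.
move=> r0 mD mf f0.
have mr : measurable_fun [set: measurableTypeR R]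
    ((fun t => r * t) : measurableTypeR R -> measurableTypeR R).
  by apply: measurable_funM => //; exact: measurable_cst.
rewrite -[LHS](ge0_integral_pushforward mr (@lebesgue_measure R) mD mf)//.
have r0' : 0 <= r^-1 by rewrite invr_ge0 ltW.
have -> : r^-1 = (NngNum r0')%:num by [].
rewrite -ge0_integral_mscale//.
by apply: eq_measure_integral => A mA _; exact: lebesgue_measure_scale.
Qed.

Section dilation_average.
Context {R : realType} {d : nat}.
Local Notation E := (euclid R d).
Local Notation leb := (lebesgue R d).
Local Notation leb1 := (@lebesgue_measure R).
Variables (W : set E) (mW : measurable W) (Wc : W `<=` cube).
Implicit Types (n : d.-tuple int) (t : R) (x y xi v : E).

(** The squared modulus of the Fourier transform of the indicator of W at tn. *)
Definition sqr_fourier n t := cosW W t n ^+ 2 + sinW W t n ^+ 2.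

Let continuous_trigW (g : R -> R) n : continuous g -> (forall u, `|g u| <= 1) ->
  continuous (fun t => \int[leb]_(y in W) g (phase n (scalev t y)) : R).
Proof.
move=> cg g1 a.
have Ia : a \in `](a - 1), (a + 1)[%classic.
  by rewrite inE /= in_itv/=; apply/andP; split; lra.
apply: (@continuity_under_integral R _ E leb (fun t y => g (phase n (scalev t y))) W mW
  (a - 1) (a + 1) _ _ (cst 1) _ _ a Ia).
- move=> t _; apply: (integrable_bounded mW Wc (M := 1)); last by move=> y _; exact: g1.
  apply: measurable_funTS.
  have := measurableT_comp (continuous_measurable_fun cg) (measurable_phase_scalev n t 0).
  by under eq_fun do rewrite /= addr0.
- apply: aeW => y _ t _; under eq_fun do rewrite phase_scalev.
  by apply: continuous_comp; [exact: mulrr_continuous|exact: cg].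
- apply: (integrable_bounded mW Wc (M := 1)); first exact: measurable_cst.
  by move=> x _ /=; rewrite normr1.
- by move=> t _; apply: aeW => y _; exact: g1.
Qed.

Lemma continuous_sqr_fourier n : continuous (sqr_fourier n).
Proof.
have cc : continuous (fun t => cosW W t n).
  by apply: continuous_trigW; [exact: continuous_cos|exact: cos_max].
have cs : continuous (fun t => sinW W t n).
  by apply: continuous_trigW; [exact: continuous_sin|exact: sin_max].
move=> t; apply: cvgD; rewrite expr2; under eq_fun do rewrite expr2.
  by apply: cvgM; exact: cc.
by apply: cvgM; exact: cs.
Qed.

Lemma sqr_fourier_ge0 n t : 0 <= sqr_fourier n t.
Proof. by rewrite addr_ge0// sqr_ge0. Qed.

(** Restricting t to [1/2, 1] makes the factor t^(2d) at least 4^-d. *)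
Lemma le_dilation_average (N : nat) (z : 'I_N -> E) (F : finType)
    (n : F -> d.-tuple int) (w : F -> R) :
  (forall j, cube (z j)) ->
  injective n -> (forall j, exists i, tnth (n j) i != 0) ->
  (forall j, ((w j)%:E <= \int[leb1]_(t in `[2^-1%R, 1%R]) (sqr_fourier (n j) t)%:E)%E) ->
  ((4^-1 ^+ d * \sum_j (cos_sum z (n j) ^+ 2 + sin_sum z (n j) ^+ 2) * w j)%:E <=
   \int[leb1]_(t in `]0%R, 1%R])
      \int[leb]_(x in cube) (`|discrepancy W z x t| ^+ 2)%:E)%E.
Proof.
move=> cz n_inj n0 hw.
pose e j := cos_sum z (n j) ^+ 2 + sin_sum z (n j) ^+ 2.
have e0 j : 0 <= e j by rewrite addr_ge0// sqr_ge0.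
pose h t := \sum_j e j * (t ^+ (2 * d) * sqr_fourier (n j) t).
have h0 t : 0 <= h t.
  apply: sumr_ge0 => j _; rewrite mulr_ge0// mulr_ge0 ?sqr_fourier_ge0//.
  by rewrite exprM exprn_ge0// sqr_ge0.
have mT j : measurable_fun [set: R] (sqr_fourier (n j)).
  by apply: continuous_measurable_fun; exact: continuous_sqr_fourier.
have mh : measurable_fun [set: R] h.
  apply: measurable_sum => j; apply: measurable_funM => //.
  apply: measurable_funM => //; exact: measurable_funX.
have mhE : measurable_fun [set: R] (EFin \o h) by exact/measurable_EFinP.
apply: (@le_trans _ _ (\int[leb1]_(t in `]0%R, 1%R]) (h t)%:E)%E); last first.
  apply: ge0_le_integral_nonmeasurable; first by move=> t _; rewrite lee_fin.
  by move=> t /=; rewrite in_itv/= => t01; exact: le_integral_discrepancy.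
have sub : (`[2^-1%R, 1%R] : set R) `<=` `]0%R, 1%R].
  by move=> t /=; rewrite !in_itv/= => /andP[? ?]; apply/andP; split => //; lra.
apply: (@le_trans _ _ (\int[leb1]_(t in `[2^-1%R, 1%R]) (h t)%:E)%E); last first.
  apply: ge0_subset_integral => //; first exact: measurable_funTS.
  by move=> t _; rewrite lee_fin.
pose h1 t : \bar R := (\sum_j (4^-1 ^+ d * e j)%R%:E * (sqr_fourier (n j) t)%:E)%E.
apply: (@le_trans _ _ (\int[leb1]_(t in `[2^-1%R, 1%R]) h1 t)%E); last first.
  apply: ge0_le_integral_nonmeasurable.
    move=> t _; apply: sume_ge0 => j _.
    by rewrite -EFinM lee_fin !mulr_ge0 ?sqr_fourier_ge0// exprn_ge0.
  move=> t /=; rewrite in_itv/= => /andP[t1 t2].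
  rewrite /h1 /h; under eq_bigr do rewrite -EFinM.
  rewrite sumEFin lee_fin; apply: ler_sum => j _.
  rewrite mulrAC mulrC ler_wpM2l// ler_wpM2r ?sqr_fourier_ge0//.
  rewrite exprM lerXn2r ?nnegrE ?sqr_ge0//; nra.
have mTE j : measurable_fun (`[2^-1%R, 1%R]%classic : set R) (EFin \o sqr_fourier (n j)).
  by apply: measurable_funTS; apply/measurable_EFinP.
have c0 j : 0 <= 4^-1 ^+ d * e j by rewrite mulr_ge0// exprn_ge0.
rewrite ge0_integral_sum//; last 2 first.
- by move=> j; apply: measurable_funeM; exact: mTE.
- by move=> j t _; rewrite -EFinM lee_fin mulr_ge0// sqr_fourier_ge0.
rewrite mulr_sumr -sumEFin; apply: lee_sum => j _.
rewrite ge0_integralZl//; [|exact: mTE|by move=> t _; rewrite lee_fin sqr_fourier_ge0|by rewrite lee_fin c0].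
rewrite mulrA EFinM; apply: lee_wpmul2l; [by rewrite lee_fin; exact: c0|exact: hw].
Qed.

Lemma sqr_fourierE n (r rho : R) :
  normc (fourier_indic W (scalev rho (scalev r^-1 (intv n)))) ^+ 2 =
  sqr_fourier n (rho / r).
Proof.
have phE y : 2 * pi * dotp (scalev rho (scalev r^-1 (intv n))) y =
    phase n (scalev (rho / r) y).
  by rewrite !dotpZl phase_scalev /phase; ring.
rewrite /fourier_indic /cintegral /= sqr_sqrtr ?addr_ge0 ?sqr_ge0//.
rewrite /sqr_fourier; congr (_ + _).
  by congr (_ ^+ 2); apply: eq_Rintegral => y _; rewrite cosN phE.
rewrite -[RHS]sqrrN; congr (_ ^+ 2).
rewrite -mulN1r -RintegralZl//; last exact: (@integrable_sinW).
  by apply: eq_Rintegral => y _; rewrite sinN phE mulN1r.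
Qed.

(** The substitution rho = rt turns the average over [A, 2A] in the direction of n
into an integral over t in [1/2, 1], where r is the length of n. *)
Lemma le_average_sqr_fourier n (r c A : R) : 0 < r -> r = 2 * A ->
  (c%:E <= (A^-1)%R%:E * \int[leb1]_(rho in `[A, (2 * A)%R])
     (normc (fourier_indic W (scalev rho (scalev r^-1 (intv n)))) ^+ 2)%R%:E)%E ->
  ((c / 2)%:E <= \int[leb1]_(t in `[2^-1%R, 1%R]) (sqr_fourier n t)%:E)%E.
Proof.
move=> r0 rA hc.
have mT : measurable_fun [set: R] (fun s : R => sqr_fourier n (s / r)).
  have mdiv : measurable_fun [set: R] (fun s : R => s / r).
    by apply: measurable_funM => //; exact: measurable_cst.
  exact: (measurableT_comp (continuous_measurable_fun (@continuous_sqr_fourier n)) mdiv).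
have := @ge0_integral_scale1 R r `[A, (2 * A)] (fun s : R => (sqr_fourier n (s / r))%:E) r0.
have -> : (fun t => r * t) @^-1` `[A, (2 * A)] = `[2^-1, 1]%classic.
  apply/seteqP; split=> t /=; rewrite !in_itv/= => /andP[? ?]; apply/andP; split; nra.
under eq_integral do rewrite mulrAC divff ?gt_eqF// mul1r.
move=> -> //; last 2 first.
- by apply: measurable_funTS; apply/measurable_EFinP.
- by move=> x; rewrite lee_fin sqr_fourier_ge0.
apply: le_trans (_ : (2^-1%:E * c%:E <= _)%E).
  by rewrite -EFinM lee_fin mulrC.
apply: le_trans (lee_wpmul2l _ hc) _; first by rewrite lee_fin.
rewrite muleA -EFinM -invfM -rA.
by apply: lee_wpmul2l; [rewrite lee_fin invr_ge0 ltW|under eq_integral do rewrite sqr_fourierE].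
Qed.

End dilation_average.

(** * Fejer kernels and exponential sums *)

Section tent.

Definition tent (c : nat) (s : int) : nat := (c - `|s|)%N.

(** The integers s with |s| <= c, listed with an offset M so that all windows are
summed over one index range. *)
Lemma sum_window (V : nmodType) (f : int -> V) (c M : nat) : (c <= M)%N ->
  \sum_(0 <= s < M.*2.+1) f (s%:Z - M%:Z) *+ (`|s%:Z - M%:Z| <= c)%N =
  \sum_(0 <= k < c.*2.+1) f (k%:Z - c%:Z).
Proof.
move=> cM.
rewrite (big_cat_nat (n := (M - c)%N))/=; [|lia|lia].
rewrite [X in _ + X](big_cat_nat (n := (M + c).+1))/=; [|lia|lia].
rewrite [X in X + _]big_nat_cond [X in X + _]big1 ?add0r; last first.
  move=> s /andP[/andP[_ s1] _]; rewrite (_ : (_ <= _)%N = false)//.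
  by apply/negbTE; lia.
rewrite [X in _ + X]big_nat_cond [X in _ + X]big1 ?addr0; last first.
  move=> s /andP[/andP[s1 _] _]; rewrite (_ : (_ <= _)%N = false)//.
  by apply/negbTE; lia.
rewrite -{1}[(M - c)%N]add0n big_addn (_ : ((M + c).+1 - (M - c) = c.*2.+1)%N); last lia.
rewrite !big_nat; apply: eq_bigr => s s1.
rewrite (_ : (_ <= _)%N = true) ?mulr1n; last by lia.
by congr f; lia.
Qed.

(** The number of pairs of elements of [0, c) with difference s is c - |s|, cut off
at 0 by truncated subtraction. *)
Lemma sum_difference (V : nmodType) (f : int -> V) (c M : nat) : (c <= M)%N ->
  \sum_(0 <= m < c) \sum_(0 <= m' < c) f (m%:Z - m'%:Z) =
  \sum_(0 <= s < M.*2.+1) f (s%:Z - M%:Z) *+ tent c (s%:Z - M%:Z).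
Proof.
elim: c => [|c IH] cM.
  by rewrite big_geq// big1// => s _; rewrite /tent sub0n mulr0n.
have tentS s : tent c.+1 s = (tent c s + (`|s| <= c))%N.
  by rewrite /tent; case: leqP => ?; lia.
under [RHS]eq_bigr do rewrite tentS mulrnDr.
rewrite big_split/= -IH; last exact: ltnW.
rewrite sum_window; last exact: ltnW.
rewrite big_nat_recr//= big_nat_recr//= subrr.
under eq_bigr do rewrite big_nat_recr//=.
rewrite big_split/= -!addrA; congr (_ + _).
rewrite [RHS](big_cat_nat (n := c))/=; [|lia|lia].
congr (_ + _).
rewrite -[X in \sum_(X <= _ < c.*2.+1) _]add0n big_addn (_ : (c.*2.+1 - c = c.+1)%N); last lia.
rewrite [RHS]big_nat_recl// addrC; congr (_ + _); first by congr f; lia.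
rewrite big_nat_rev; rewrite !big_nat; apply: eq_bigr => s s1.
by congr f; lia.
Qed.

End tent.

Section fejer.
Context {R : realType}.
Implicit Types (x : R) (c M : nat) (s : int).

(** |sum_(m < c) exp(imx)|^2, the (unnormalised) Fejer kernel. *)
Definition fejer c x : R :=
  (\sum_(0 <= m < c) cos (m%:R * x)) ^+ 2 + (\sum_(0 <= m < c) sin (m%:R * x)) ^+ 2.

Lemma fejer_ge0 c x : 0 <= fejer c x.
Proof. by rewrite addr_ge0// sqr_ge0. Qed.

Lemma fejer0 c : fejer c 0 = c%:R ^+ 2.
Proof.
rewrite /fejer; under eq_bigr do rewrite mulr0 cos0.
under [X in _ + X ^+ 2]eq_bigr do rewrite mulr0 sin0.
by rewrite !sumr_const_nat subn0 mul0rn expr0n addr0.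
Qed.

(** The geometric sum of length 2c is the one of length c times 1 + exp(icx). *)
Lemma fejer_double c x : fejer (c + c) x <= 4 * fejer c x.
Proof.
rewrite /fejer; set A := \sum_(0 <= m < c) cos _; set B := \sum_(0 <= m < c) sin _.
have split2 (g : R -> R) : \sum_(0 <= m < c + c) g (m%:R * x) =
    \sum_(0 <= m < c) g (m%:R * x) + \sum_(0 <= m < c) g (m%:R * x + c%:R * x).
  rewrite (big_cat_nat (n := c))/=; [|lia|lia]; congr (_ + _).
  rewrite -[X in \sum_(X <= _ < c + c) _]add0n big_addn addnK; apply: eq_bigr => m _.
  by rewrite natrD mulrDl.
rewrite !split2 -/A -/B.
under eq_bigr do rewrite cosD.
under [X in _ + (_ + X) ^+ 2]eq_bigr do rewrite sinD.
rewrite sumrB big_split/= -!mulr_suml -/A -/B.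
have := cos2Dsin2 (c%:R * x); have := cos_le1 (c%:R * x).
move: (cos _) (sin _) => C S C1 CS.
have -> : (A + (A * C - B * S)) ^+ 2 + (B + (B * C + A * S)) ^+ 2 =
  (A ^+ 2 + B ^+ 2) * (1 + 2 * C + (C ^+ 2 + S ^+ 2)) by ring.
rewrite CS mulrC ler_wpM2r ?addr_ge0 ?sqr_ge0//; lra.
Qed.

Lemma expiD (u v : R) : expi (u + v) = expi u * expi v.
Proof. by rewrite /expi cosD sinD; congr Complex; rewrite addrC; ring. Qed.

Lemma expi_sum (J : Type) (r : seq J) (P : pred J) (u : J -> R) :
  expi (\sum_(j <- r | P j) u j) = \prod_(j <- r | P j) expi (u j).
Proof.
elim/big_rec2: _ => [|j v z _ <-]; first by rewrite /expi cos0 sin0.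
exact: expiD.
Qed.

Lemma sum_expi (J : Type) (r : seq J) (P : pred J) (u : J -> R) :
  \sum_(j <- r | P j) expi (u j) =
  Complex (\sum_(j <- r | P j) cos (u j)) (\sum_(j <- r | P j) sin (u j)).
Proof. by elim/big_rec3: _ => [|j C S z _ ->]. Qed.

Lemma expi_autocorrelation (J : Type) (r : seq J) (u : J -> R) :
  \sum_(j <- r) \sum_(k <- r) expi (u j - u k) =
  ((\sum_(j <- r) cos (u j)) ^+ 2 + (\sum_(j <- r) sin (u j)) ^+ 2)%:C%C.
Proof.
under eq_bigr do under eq_bigr do rewrite expiD.
under eq_bigr do rewrite -mulr_sumr.
rewrite -mulr_suml !sum_expi.
under [X in _ * Complex X _]eq_bigr do rewrite cosN.
under [X in _ * Complex _ X]eq_bigr do rewrite sinN.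
rewrite sumrN; apply/eqP; rewrite eq_complex /=; apply/andP.
by split; apply/eqP; ring.
Qed.

Lemma fejerE c x : (fejer c x)%:C%C = \sum_(0 <= m < c) \sum_(0 <= m' < c)
  expi ((m%:Z - m'%:Z)%:~R * x).
Proof.
rewrite /fejer -expi_autocorrelation; apply: eq_bigr => m _; apply: eq_bigr => k _.
by rewrite intrB mulrBl.
Qed.

Lemma fejer_tent c M x : (c <= M)%N ->
  (fejer c x)%:C%C = \sum_(s < M.*2.+1) expi ((s%:Z - M%:Z)%:~R * x) *+ tent c (s%:Z - M%:Z).
Proof.
move=> cM; rewrite fejerE (sum_difference (fun s => expi (s%:~R * x)) cM).
by rewrite big_mkord.
Qed.

End fejer.

Section energy.
Context {R : realType} {d N : nat}.
Implicit Types (y : 'I_N -> 'I_d -> R) (nu : 'I_d -> int) (c : 'I_d -> nat).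

Definition angle y nu (k : 'I_N) : R := 2 * pi * \sum_i (nu i)%:~R * y k i.

(** |sum_k exp(2 pi i nu.y_k)|^2 *)
Definition energy y nu : R :=
  (\sum_k cos (angle y nu k)) ^+ 2 + (\sum_k sin (angle y nu k)) ^+ 2.

Lemma energyE y nu :
  (energy y nu)%:C%C = \sum_k \sum_l expi (angle y nu k - angle y nu l).
Proof. by rewrite expi_autocorrelation. Qed.

Lemma energy_ge0 y nu : 0 <= energy y nu.
Proof. by rewrite addr_ge0// sqr_ge0. Qed.

Lemma energy_le y nu : energy y nu <= N%:R ^+ 2 *+ 2.
Proof.
have h (g : R -> R) : (forall u, `|g u| <= 1) -> (\sum_k g (angle y nu k)) ^+ 2 <= N%:R ^+ 2.
  move=> g1; rewrite -[leLHS]real_normK ?num_real//.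
  rewrite lerXn2r ?nnegrE// (le_trans (ler_norm_sum _ _ _))//.
  rewrite -[leRHS](_ : \sum_(k < N) 1 = _); last by rewrite sumr_const card_ord.
  exact: ler_sum.
by rewrite mulr2n lerD// h//; [exact: cos_max|exact: sin_max].
Qed.

(** Every nu whose coordinates are at most M in absolute value, the offset M making
the index set a finite type. *)
Definition freq M (F : {ffun 'I_d -> 'I_(M.*2.+1)}) (i : 'I_d) : int := (F i)%:Z - M%:Z.

(** The sum of the energies of mu - mu' over pairs mu, mu' of integer points of the
box with sides c. *)
Definition tent_mass M y c : R :=
  \sum_(F : {ffun 'I_d -> 'I_(M.*2.+1)})
    energy y (freq F) *+ \prod_i tent (c i) (freq F i).

(** The energy is a double sum of characters over the pairs of points; summing over
the frequencies first gives a product of one-dimensional kernels. *)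
Lemma tent_mass_fejer M y c : (forall i, (c i <= M)%N) ->
  tent_mass M y c =
  \sum_k \sum_l \prod_i fejer (c i) (2 * pi * (y k i - y l i)).
Proof.
move=> cM; apply: complexI.
rewrite !rmorph_sum /=.
transitivity (\sum_k \sum_l \sum_(F : {ffun 'I_d -> 'I_(M.*2.+1)})
   expi (angle y (freq F) k - angle y (freq F) l) *+ \prod_i tent (c i) (freq F i)).
  under [RHS]eq_bigr do rewrite exchange_big.
  rewrite [RHS]exchange_big; apply: eq_bigr => F _ /=.
  rewrite rmorphMn /= [X in X *+ _]energyE.
  rewrite -sumrMnl; apply: eq_bigr => k _; by rewrite -sumrMnl.
apply: eq_bigr => k _; rewrite rmorph_sum; apply: eq_bigr => l _ /=.
rewrite rmorph_prod /=; under [RHS]eq_bigr do rewrite (fejer_tent _ (cM _)).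
rewrite bigA_distr_bigA/=; apply: eq_bigr => F _.
rewrite prodrMn -expi_sum; congr (expi _ *+ _).
rewrite /angle -mulrBr -sumrB mulr_sumr; apply: eq_bigr => i _.
by rewrite /freq -mulrBr; ring.
Qed.

(** This holds for each pair of points separately, the kernels being nonnegative. *)
Lemma le_tent_mass_double M y c i0 : (forall i, (c i <= M)%N) -> (c i0 + c i0 <= M)%N ->
  tent_mass M y (fun i => if i == i0 then (c i + c i)%N else c i) <= 4 * tent_mass M y c.
Proof.
move=> cM c0M; rewrite !tent_mass_fejer//; last first.
  by move=> i; case: eqP => // ->.
rewrite mulr_sumr; apply: ler_sum => k _; rewrite mulr_sumr; apply: ler_sum => l _.
rewrite (bigD1 i0)//= [in leRHS](bigD1 i0)//= eqxx mulrA.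
rewrite (eq_bigr (fun i => fejer (c i) (2 * pi * (y k i - y l i)))); last first.
  by move=> i /negbTE ->.
by rewrite ler_wpM2r ?fejer_double// prodr_ge0// => i _; exact: fejer_ge0.
Qed.

(** The diagonal k = l alone; the other terms are nonnegative. *)
Lemma tent_mass_ge M y c : (forall i, (c i <= M)%N) ->
  N%:R * \prod_i (c i)%:R ^+ 2 <= tent_mass M y c.
Proof.
move=> cM; rewrite tent_mass_fejer//.
rewrite -[X in X%:R]card_ord -sum1_card natr_sum mulr_suml; apply: ler_sum => k _.
rewrite mul1r (bigD1 k)//=.
under [X in _ <= X + _]eq_bigr do rewrite subrr mulr0 fejer0.
by rewrite lerDl sumr_ge0// => l _; rewrite prodr_ge0// => i _; exact: fejer_ge0.
Qed.

End energy.

(** * Stretching anisotropic boxes *)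

Section chain.
Context {R : realType} {d N : nat}.
Variables (y : 'I_N -> 'I_d -> R) (i0 : 'I_d) (M R1 : nat) (c0 D : R).
Implicit Types (nu : 'I_d -> int) (a b : nat).

Definition sup_norm nu : nat := \max_i `|nu i|%N.

(** In the lattice adapted to v, these are frequencies almost orthogonal to v. *)
Definition off_axis nu : bool := [exists j, (j != i0) && (`|nu i0| <= `|nu j|)%N].

(** The lower bound, in terms of the sup norm of nu, that the hypothesis gives for the
mean over t of the squared transform at t times a lattice point. *)
Definition weight nu : R := c0 / (sup_norm nu)%:R ^+ (if off_axis nu then d.+1 else d.+2).

Hypotheses (c00 : 0 < c0) (R10 : (0 < R1)%N).
Hypothesis hD : \sum_(F : {ffun 'I_d -> 'I_(M.*2.+1)} | (R1 <= sup_norm (freq F))%N)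
  energy y (freq F) * weight (freq F) <= D.

Local Notation FF := {ffun 'I_d -> 'I_(M.*2.+1)}.
Local Notation en F := (energy y (freq F)).

Lemma sum_energy_le (P : pred FF) (k : R) : 0 < k ->
  (forall F, P F -> (R1 <= sup_norm (freq F))%N /\ k <= weight (freq F)) ->
  \sum_(F | P F) en F <= D / k.
Proof.
move=> k0 hP; rewrite ler_pdivlMr// mulr_suml; apply: le_trans hD.
rewrite [leLHS]big_mkcond [leRHS]big_mkcond; apply: ler_sum => F _.
case: ifPn => [/hP[-> kF]|_]; first by rewrite ler_wpM2l// energy_ge0.
case: ifPn => // _; rewrite mulr_ge0 ?energy_ge0// divr_ge0 ?exprn_ge0//.
exact: ltW.
Qed.

Lemma bound_ge0 : 0 <= D.
Proof.
apply: le_trans hD; apply: sumr_ge0 => F _.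
by rewrite mulr_ge0 ?energy_ge0// divr_ge0 ?exprn_ge0// ltW.
Qed.

Definition side a b (i : 'I_d) : nat := if i == i0 then a else b.

Definition mass a b : R := tent_mass M y (side a b).

Lemma prod_side (f : nat -> R) a b :
  \prod_i f (side a b i) = f a * f b ^+ d.-1.
Proof.
rewrite (bigD1 i0)//= {1}/side eqxx; congr (_ * _).
rewrite (eq_bigr (fun=> f b)); last by move=> i /negbTE ii0; rewrite /side ii0.
rewrite prodr_const; congr (_ ^+ _).
by have := cardC1 i0; rewrite card_ord => <-.
Qed.

(** The axial side is quadrupled at a cost of 16, that is 4 after normalising by the
number of points of the box. *)
Lemma mass_quadruple a b : (4 * a <= M)%N -> (b <= M)%N ->
  mass (4 * a) b <= 16 * mass a b.
Proof.
move=> aM bM.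
have dbl a' : (a' + a' <= M)%N -> mass (a' + a') b <= 4 * mass a' b.
  move=> a'M; have sM i : (side a' b i <= M)%N by rewrite /side; case: ifP => _; lia.
  have /= := le_tent_mass_double y (i0 := i0) sM; rewrite {1 2}/side eqxx => /(_ a'M).
  rewrite /mass (_ : side (a' + a') b =
    fun i => if i == i0 then (side a' b i + side a' b i)%N else side a' b i)//.
  by apply/funext => i; rewrite /side; case: ifP.
have -> : (4 * a = (a + a) + (a + a))%N by lia.
apply: le_trans (dbl _ _) _; first by lia.
have aa : (a + a <= M)%N by lia.
by have := dbl a aa; lra.
Qed.

Definition inner a nu := [forall j, (j != i0) ==> (`|nu j| < a)%N].
Definition supp a b nu := [forall j, (`|nu j| < side a b j)%N].

Lemma sup_norm_leP nu (a : nat) : reflect (forall i, (`|nu i| <= a)%N) (sup_norm nu <= a)%N.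
Proof.
apply: (iffP idP) => [h i|h].
  by apply: leq_trans h; exact: (leq_bigmax_cond (F := fun i => `|nu i|%N)).
by apply/bigmax_leqP => i _; exact: h.
Qed.

Lemma leq_sup_norm nu i : (`|nu i| <= sup_norm nu)%N.
Proof. exact/sup_norm_leP. Qed.

(** A frequency of the box outside the inner one has |nu_i0| < a <= |nu_j| for some
j, so it is off the axis and of sup norm at most b. *)
Lemma sum_outer_le a b : (R1 <= a)%N -> (a <= b)%N -> 
  \sum_(F : FF | supp a b (freq F) && ~~ inner a (freq F)) en F <=
  D * b%:R ^+ d.+1 / c0.
Proof.
move=> R1a ab; have b0 : (0 < b)%N by lia.
rewrite -mulrA -[_ / c0]invf_div; apply: sum_energy_le.
  by rewrite divr_gt0// exprn_gt0// ltr0n.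
move=> F /andP[/forallP sF]; rewrite negb_forall => /existsP[j].
rewrite negb_imply -leqNgt => /andP[ji aj].
have sj : (R1 <= sup_norm (freq F))%N by have := leq_sup_norm (freq F) j; lia.
have sb : (sup_norm (freq F) <= b)%N.
  by apply/sup_norm_leP => i; have := sF i; rewrite /side; case: ifP => _; lia.
split=> //; rewrite /weight (_ : off_axis _ = true); last first.
  apply/existsP; exists j; rewrite ji /=.
  by have := sF i0; rewrite /side eqxx; lia.
rewrite ler_wpM2l ?(ltW c00)// lef_pV2 ?posrE ?exprn_gt0 ?ltr0n//; last by lia.
by rewrite lerXn2r ?nnegrE// ler_nat.
Qed.

Lemma prod_tent_le a b nu : supp a b nu = false -> (\prod_i tent (side a b i) (nu i) = 0)%N.
Proof.
move/negbT; rewrite negb_forall => /existsP[j]; rewrite -leqNgt => sj.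
by rewrite (bigD1 j)//= /tent (eqP (_ : _ - _ == 0)%N) ?mul0n// subn_eq0.
Qed.

Lemma prod_tent_le_side a b nu : (\prod_i tent (side a b i) (nu i))%:R <= a%:R * b%:R ^+ d.-1 :> R.
Proof.
rewrite -(prod_side (fun n => n%:R)) natr_prod; apply: ler_prod => i _.
by rewrite ler0n ler_nat leq_subr.
Qed.

(** On the inner frequencies the two tents differ by a factor 2b/(b - a) in each
transversal direction; the outer ones are controlled by [sum_outer_le]. *)
Lemma mass_step a b : (R1 <= a)%N -> (a < b)%N -> (b + b <= M)%N ->
  mass a (b + b) <= (2 * b%:R / (b%:R - a%:R)) ^+ d.-1 * mass a b +
    a%:R * (b + b)%:R ^+ d.-1 * (D * (b + b)%:R ^+ d.+1 / c0).
Proof.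
move=> R1a ab bM.
have ba0 : 0 < b%:R - a%:R :> R by rewrite subr_gt0 ltr_nat.
set k := 2 * b%:R / _.
have k0 : 0 <= k by rewrite divr_ge0// ?ltW//; nra.
rewrite /mass /tent_mass (bigID (fun F : FF => inner a (freq F)))/=; apply: lerD.
  rewrite mulr_sumr [leLHS]big_mkcond; apply: ler_sum => F _; case: ifPn => [/forallP iF|_]; last first.
    by rewrite mulr_ge0 ?exprn_ge0// mulrn_wge0// energy_ge0.
  rewrite -[leLHS]mulr_natl -[X in _ <= _ * X]mulr_natl mulrA ler_wpM2r ?energy_ge0// !natr_prod.
  rewrite -[k ^+ _](_ : \prod_i (if i == i0 then 1 else k) = _); last first.
    rewrite (bigD1 i0)//= eqxx mul1r (eq_bigr (fun=> k)); last by move=> i /negbTE ->.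
    by rewrite prodr_const; congr (_ ^+ _); have := cardC1 i0; rewrite card_ord => <-.
  rewrite -big_split; apply: ler_prod => i _; rewrite ler0n /= /side.
  have := iF i; case: eqP => [_ _|_ /= fa]; first by rewrite mul1r.
  rewrite mulrAC ler_pdivlMr// /tent !natrB; [|lia..].
  have : (`|freq F i|%N)%:R <= a%:R :> R by rewrite ler_nat ltnW.
  have : 0 <= (`|freq F i|%N)%:R :> R by [].
  have : a%:R < b%:R :> R by rewrite ltr_nat.
  have : 0 <= a%:R :> R by [].
  rewrite natrD; nra.
apply: le_trans (_ : \sum_(F : FF | supp a (b + b) (freq F) && ~~ inner a (freq F))
   a%:R * (b + b)%:R ^+ d.-1 * en F <= _).
  rewrite [leLHS]big_mkcond [leRHS]big_mkcond; apply: ler_sum => F _.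
  case: (boolP (inner _ _)) => iF; rewrite ?andbF//= andbT.
  case: ifPn => sF; last by rewrite prod_tent_le ?mulr0n//; exact/negbTE.
  by rewrite -[leLHS]mulr_natl ler_wpM2r ?energy_ge0// prod_tent_le_side.
rewrite -mulr_sumr ler_wpM2l ?mulr_ge0 ?exprn_ge0//.
by apply: sum_outer_le => //; lia.
Qed.

(** The mass per point of the box. *)
Definition density a b : R := mass a b / (a%:R * b%:R ^+ d.-1).

Lemma density_step a b : (R1 <= a)%N -> (a < b)%N -> (b + b <= M)%N -> (4 * a <= M)%N ->
  ((b%:R - a%:R) / b%:R) ^+ d.-1 * density (4 * a) (b + b) <=
  4 * density a b + 4 * (D * (b + b)%:R ^+ d.+1 / c0).
Proof.
move=> R1a ab bM aM.
have a0 : 0 < a%:R :> R by rewrite ltr0n; lia.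
have b0 : 0 < b%:R :> R by rewrite ltr0n; lia.
have ba0 : 0 < b%:R - a%:R :> R by rewrite subr_gt0 ltr_nat.
have E0 : 0 <= D * (b + b)%:R ^+ d.+1 / c0.
  by rewrite divr_ge0 ?mulr_ge0 ?bound_ge0 ?exprn_ge0 ?(ltW c00)//.
have := le_trans (mass_quadruple aM bM) (ler_wpM2l (_ : 0 <= 16) (mass_step R1a ab bM)).
move=> /(_ (ler0n _ _)); move: E0; set E := D * _ / _ => E0.
rewrite /density natrD -mulr2n -[b%:R *+ 2]mulr_natl natrM.
move: (mass (4 * a) _) (mass a b) => m4 m1.
rewrite -[2 * b%:R / _]mulrA !exprMn !exprVn.
set A := (2 : R) ^+ _; set B := b%:R ^+ _; set C := (_ - _) ^+ d.-1.
have A0 : 0 < A by rewrite exprn_gt0.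
have B0 : 0 < B by rewrite exprn_gt0.
have C0 : 0 < C by rewrite exprn_gt0.
move=> h.
have -> : 4 * (m1 / (a%:R * B)) + 4 * E =
  C / B * ((16 * (A * (B / C) * m1 + a%:R * (A * B) * (E * (B / C)))) / (4 * a%:R * (A * B))).
  by field; rewrite !gt_eqF.
have den0 : 0 < 4 * a%:R * (A * B) by rewrite !mulr_gt0.
apply: ler_wpM2l; first by rewrite divr_ge0// ltW.
apply: ler_wpM2r; first by rewrite invr_ge0 ltW.
apply: le_trans h _; rewrite ler_pM2l// lerD2l.
apply: ler_wpM2l; first by rewrite !mulr_ge0// ltW.
rewrite ler_peMr// ler_pdivlMr// mul1r.
by rewrite lerXn2r ?nnegrE ?(ltW ba0) ?(ltW b0)// gerBl (ltW a0).
Qed.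

Lemma density_ge a b : (a <= M)%N -> (b <= M)%N -> (0 < a)%N -> (0 < b)%N ->
  N%:R * (a%:R * b%:R ^+ d.-1) <= density a b.
Proof.
move=> aM bM a0 b0; rewrite ler_pdivlMr ?mulr_gt0 ?exprn_gt0 ?ltr0n//.
have sM i : (side a b i <= M)%N by rewrite /side; case: ifP.
apply: le_trans (tent_mass_ge y sM).
rewrite (prod_side (fun n => n%:R ^+ 2)) -mulrA -!expr2 exprMn.
by rewrite -!exprM mulnC.
Qed.

Lemma card_small : (R1 <= M)%N ->
  (#|[pred F : FF | (sup_norm (freq F) < R1)%N]| <= (R1 + R1) ^ d)%N.
Proof.
move=> R1M.
pose S := [pred s : 'I_(M.*2.+1) | (`|s%:Z - M%:Z| <= R1.-1)%N].
have cS : (#|S| <= R1 + R1)%N.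
  have := sum_window (fun=> 1%N) (c := R1.-1) (M := M); rewrite big_mkord.
  move=> /(_ ltac:(lia)); rewrite sum_nat_const_nat muln1 => h.
  rewrite -sum1_card big_mkcond /=.
  rewrite (eq_bigr (fun s : 'I_(M.*2.+1) => (1 *+ (`|s%:Z - M%:Z| <= R1.-1))%N)).
    by rewrite h; lia.
  by move=> s _; rewrite inE; case: (_ <= _)%N.
apply: leq_trans (_ : #|@ffun_on_mem 'I_d _ (mem S)| <= _)%N.
  apply: subset_leq_card; apply/fintype.subsetP => F; rewrite inE => sF.
  apply/ffun_onP => i; rewrite inE.
  by have := leq_sup_norm (freq F) i; rewrite -[X in (`|X| <= R1.-1)%N]/(freq F i); lia.
rewrite card_ffun_on card_ord leq_exp2r; first by [].
by have := ltn_ord i0; lia.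
Qed.

(** The frequencies of the box are split into those below R1, which are bounded
trivially, the remaining ones in the cube of side a, where only the smaller weight is
available, and the outer ones. *)
Lemma density_le a b : (R1 <= a)%N -> (a <= b)%N -> (R1 <= M)%N ->
  density a b <= 2 * (R1 + R1)%:R ^+ d * N%:R ^+ 2 +
    D * a%:R ^+ d.+2 / c0 + D * b%:R ^+ d.+1 / c0.
Proof.
move=> R1a ab R1M.
have a0 : 0 < a%:R :> R by rewrite ltr0n; lia.
have b0 : 0 < b%:R :> R by rewrite ltr0n; lia.
have ab0 : 0 < a%:R * b%:R ^+ d.-1 :> R by rewrite mulr_gt0 ?exprn_gt0.
apply: le_trans (_ : \sum_(F : FF | supp a b (freq F)) en F <= _).
  rewrite ler_pdivrMr// mulr_suml [leRHS]big_mkcond; apply: ler_sum => F _.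
  case: (boolP (supp _ _ _)) => sF; last by rewrite prod_tent_le ?mulr0n//; exact/negbTE.
  by rewrite -[leLHS]mulr_natr ler_wpM2l ?energy_ge0// prod_tent_le_side.
rewrite (bigID (fun F : FF => inner a (freq F)))/=; apply: lerD; last exact: sum_outer_le.
rewrite (bigID (fun F : FF => sup_norm (freq F) < R1)%N)/=; apply: lerD.
  apply: le_trans (_ : \sum_(F in [pred F : FF | (sup_norm (freq F) < R1)%N]) (N%:R ^+ 2 *+ 2) <= _).
    rewrite [leLHS]big_mkcond [leRHS]big_mkcond; apply: ler_sum => F _; rewrite inE.
    case: (_ < R1)%N; rewrite ?andbF ?andbT; last by [].
    by case: ifP => _; [exact: energy_le|rewrite mulrn_wge0// sqr_ge0].
  rewrite sumr_const -[leLHS]mulr_natl -[X in _ * X]mulr_natl mulrCA -!mulrA.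
  rewrite ler_wpM2l// ler_wpM2r ?sqr_ge0//.
  by rewrite -natrX ler_nat card_small.
rewrite -mulrA -[_ / c0]invf_div; apply: sum_energy_le.
  by rewrite divr_gt0// exprn_gt0.
move=> F /andP[/andP[/forallP sF /forallP iF]]; rewrite -leqNgt => RF; split => //.
have sa : (sup_norm (freq F) <= a)%N.
  apply/sup_norm_leP => i; have := sF i; have := iF i; rewrite /side; case: eqP => _ /=; lia.
have s1 : 1 <= (sup_norm (freq F))%:R :> R by rewrite ler1n; lia.
have s0 : 0 < (sup_norm (freq F))%:R :> R by lra.
have h : c0 / a%:R ^+ d.+2 <= c0 / (sup_norm (freq F))%:R ^+ d.+2.
  rewrite ler_wpM2l ?(ltW c00)// lef_pV2 ?posrE ?exprn_gt0//.
  by rewrite lerXn2r ?nnegrE ?(ltW s0) ?(ltW a0)// ler_nat.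
apply: le_trans h _; rewrite /weight; case: (off_axis _) => //.
rewrite ler_wpM2l ?(ltW c00)// lef_pV2 ?posrE ?exprn_gt0//.
by rewrite ler_weXn2l.
Qed.

(** The stronger bound 1/4 + 2^-(j+1) is preserved by the induction step. *)
Lemma prod_dyadic_ge (j : nat) : 4^-1 <= \prod_(k < j) (1 - 2^-1 ^+ k.+1) :> R.
Proof.
suff h i : 4^-1 + 2^-1 ^+ i.+2 <= \prod_(k < i.+1) (1 - 2^-1 ^+ k.+1) :> R.
  case: j => [|j]; first by rewrite big_ord0; lra.
  apply: le_trans (h j); rewrite lerDl exprn_ge0//; lra.
elim: i => [|i IH]; first by rewrite big_ord1 !exprS expr0; lra.
rewrite big_ord_recr /=; set P := \prod_(_ < _) _ in IH *.
have q0 : 0 < 2^-1 ^+ i.+1 :> R by rewrite exprn_gt0//; lra.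
have q1 : 2^-1 ^+ i.+1 <= 2^-1 :> R.
  by rewrite exprS ler_piMr//; apply: exprn_ile1; lra.
have -> : 2^-1 ^+ i.+3 = 4^-1 * 2^-1 ^+ i.+1 :> R.
  by rewrite exprS exprS mulrA; congr (_ * _); field.
move: IH; rewrite ![2^-1 ^+ i.+2]exprS; move: (2^-1 ^+ i.+1) q0 q1 => q q0 q1 IH.
have := ler_wpM2r (_ : 0 <= 1 - 2^-1 * q) IH; rewrite subr_ge0 => /(_ ltac:(lra)).
by apply: le_trans; nra.
Qed.

Variables (J Y : nat).
Hypotheses (MJ : M = (4 ^ J * Y)%N) (RY : (R1 <= Y)%N) (d2 : (2 <= d)%N).

Let aj j := (4 ^ (J - j) * Y)%N.
Let bj j := (2 ^ (J + J - j) * Y)%N.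

Let ajE j : (j <= J)%N -> (aj j)%:R = M%:R * 4^-1 ^+ j :> R.
Proof.
move=> jJ; rewrite MJ /aj -{2}(subnK jJ) expnD !natrM !natrX exprVn.
by field; rewrite expf_neq0.
Qed.

Let bjE j : (j <= J)%N -> (bj j)%:R = M%:R * 2^-1 ^+ j :> R.
Proof.
move=> jJ; have -> : (M = 2 ^ j * bj j)%N.
  rewrite MJ /bj mulnA -expnD subnKC; last lia.
  by rewrite addnn -mul2n expnM.
by rewrite natrM natrX exprVn; field; rewrite expf_neq0.
Qed.

Let K : R := 8 * D * M%:R ^+ d.+1 / c0.

Let dyadic_chain j : (j <= J)%N ->
  (\prod_(k < j) (1 - 2^-1 ^+ k.+1)) ^+ d.-1 * density M M <=
  4 ^+ j * density (aj j) (bj j) + (1 - 2^-1 ^+ j) * K.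
Proof.
have Y0 : (0 < Y)%N by lia.
have X0 : 0 < M%:R :> R by rewrite ltr0n MJ muln_gt0 expn_gt0.
have K0 : 0 <= K by rewrite divr_ge0 ?(ltW c00)// !mulr_ge0 ?bound_ge0 ?exprn_ge0.
elim: j => [|j IH] jJ.
  rewrite big_ord0 expr1n !expr0 subrr mul0r addr0 /aj /bj !subn0 -MJ.
  by rewrite (_ : (2 ^ (J + J) * Y)%N = M)// MJ addnn -mul2n expnM.
have {}IH := IH (ltnW jJ).
have aS : (4 * aj j.+1 = aj j)%N.
  by rewrite /aj mulnA -expnS; congr (4 ^ _ * _)%N; lia.
have bS : (bj j.+1 + bj j.+1 = bj j)%N.
  by rewrite /bj addnn -mul2n mulnA -expnS; congr (2 ^ _ * _)%N; lia.
have aM i : (aj i <= M)%N by rewrite MJ /aj leq_pmul2r// leq_exp2l// leq_subr.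
have bM : (bj j <= M)%N.
  by rewrite -(ler_nat R) bjE ?(ltnW jJ)// ler_piMr ?(ltW X0)// exprn_ile1//; lra.
have abj : (aj j.+1 < bj j.+1)%N.
  by rewrite /aj /bj ltn_pmul2r// (_ : 4 = 2 ^ 2)%N// -expnM ltn_exp2l//; lia.
have Ra : (R1 <= aj j.+1)%N.
  by apply: leq_trans RY _; rewrite /aj leq_pmull// expn_gt0.
have := density_step Ra abj; rewrite bS aS => /(_ bM (aM _)).
set p : R := 1 - 2^-1 ^+ j.+1.
have -> : ((bj j.+1)%:R - (aj j.+1)%:R) / (bj j.+1)%:R = p :> R.
  rewrite bjE// ajE// /p (_ : 4^-1 = 2^-1 * 2^-1 :> R); last by field.
  by rewrite exprMn; field; rewrite expf_neq0 gt_eqF.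
have q0 : 0 < 2^-1 ^+ j :> R by rewrite exprn_gt0//; lra.
have q1 : 2^-1 ^+ j <= 1 :> R by rewrite exprn_ile1//; lra.
have p0 : 0 <= p by rewrite /p exprS; lra.
have p1 : p ^+ d.-1 <= 1 by rewrite exprn_ile1//; rewrite /p exprS; lra.
move=> h.
rewrite big_ord_recr /= exprMn mulrAC mulrC.
apply: le_trans (ler_wpM2l (exprn_ge0 d.-1 p0) IH) _.
rewrite mulrDr mulrCA.
have h4 := ler_wpM2l (exprn_ge0 j (ler0n R 4)) h.
have hK : p ^+ d.-1 * ((1 - 2^-1 ^+ j) * K) <= (1 - 2^-1 ^+ j) * K.
  by rewrite ler_piMl// mulr_ge0//; lra.
have hE : 4 ^+ j * (4 * (D * (bj j)%:R ^+ d.+1 / c0)) <= 2^-1 ^+ j.+1 * K.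
  rewrite bjE; last exact: ltnW.
  have -> : 4 ^+ j * (4 * (D * (M%:R * 2^-1 ^+ j) ^+ d.+1 / c0)) =
     (4 * D * M%:R ^+ d.+1 / c0) * (4 ^+ j * (2^-1 ^+ j) ^+ d.+1).
    by rewrite exprMn; ring.
  have -> : 2^-1 ^+ j.+1 * K = (4 * D * M%:R ^+ d.+1 / c0) * 2^-1 ^+ j.
    by rewrite /K exprS; field; rewrite gt_eqF.
  apply: ler_wpM2l.
    by rewrite divr_ge0 ?(ltW c00)// !mulr_ge0 ?bound_ge0 ?exprn_ge0.
  have -> : d.+1 = (3 + (d - 2))%N by clear -d2; lia.
  rewrite exprD -[leRHS]mulr1 mulrA; apply: ler_pM.
  - by rewrite mulr_ge0 ?exprn_ge0 ?(ltW q0).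
  - by rewrite exprn_ge0 ?(ltW q0).
  - rewrite (_ : 4 = 2 * 2 :> R); last by ring.
    rewrite exprMn !exprSr expr0 mul1r exprVn le_eqVlt; apply/orP; left.
    by apply/eqP; field; rewrite expf_neq0.
  - by rewrite exprn_ile1 ?(ltW q0).
rewrite [4 ^+ j.+1]exprSr.
move: h4; rewrite mulrDr.
have -> : (1 - 2^-1 ^+ j.+1) * K = (1 - 2^-1 ^+ j) * K + 2^-1 ^+ j.+1 * K.
  by rewrite exprS; field.
by rewrite -mulrA; lra.
Qed.

(** The boxes of the chain have sides [aj j] = 4^(J-j) Y and [bj j] = 2^(2J-j) Y; j runs
from the cube of side M = 4^J Y, where the density is bounded below, to j = J,
where it is bounded above. *)
Lemma anisotropic_count :
  N%:R * M%:R ^+ d <= 4 ^+ d.-1 * (4 ^+ J * (2 * (R1 + R1)%:R ^+ d * N%:R ^+ 2) +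
    D / c0 * (4 ^+ J * Y%:R ^+ d.+2 + 9 * M%:R ^+ d.+1)).
Proof.
have Y0 : (0 < Y)%N by lia.
have M0 : (0 < M)%N by rewrite MJ muln_gt0 expn_gt0.
have X0 : 0 < M%:R :> R by rewrite ltr0n.
have RM : (R1 <= M)%N by apply: leq_trans RY _; rewrite MJ leq_pmull// expn_gt0.
have D0 : 0 <= D / c0 by rewrite divr_ge0 ?bound_ge0// ltW.
have K0 : 0 <= K by rewrite divr_ge0 ?(ltW c00)// !mulr_ge0 ?bound_ge0 ?exprn_ge0.
have aJ : aj J = Y by rewrite /aj subnn mul1n.
have bJ : bj J = (2 ^ J * Y)%N by rewrite /bj addnK.
have dn := density_ge (leqnn M) (leqnn M) M0 M0.
have chain := dyadic_chain (leqnn J).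
have du : density (aj J) (bj J) <= 2 * (R1 + R1)%:R ^+ d * N%:R ^+ 2 +
    D * Y%:R ^+ d.+2 / c0 + D * (bj J)%:R ^+ d.+1 / c0.
  rewrite -aJ; apply: density_le => //; first by rewrite aJ.
  by rewrite aJ bJ leq_pmull// expn_gt0.
have bX : 4 ^+ J * (bj J)%:R ^+ d.+1 <= M%:R ^+ d.+1 :> R.
  rewrite bjE// exprMn mulrCA ler_piMr ?exprn_ge0//.
  have -> : d.+1 = (2 + (d - 1))%N by clear -d2; lia.
  rewrite exprD mulrA -[leRHS]mulr1; apply: ler_pM.
  - by rewrite mulr_ge0 ?exprn_ge0//; lra.
  - by rewrite exprn_ge0// exprn_ge0//; lra.
  - rewrite -exprM mulnC exprM -exprMn exprn_ile1//; lra.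
  - by rewrite exprn_ile1 ?exprn_ge0 ?exprn_ile1//; lra.
have P1 : 4^-1 ^+ d.-1 * density M M <=
    (\prod_(k < J) (1 - 2^-1 ^+ k.+1)) ^+ d.-1 * density M M.
  apply: ler_wpM2r.
    by apply: le_trans dn; rewrite !mulr_ge0 ?exprn_ge0.
  by rewrite lerXn2r ?nnegrE ?prod_dyadic_ge// (le_trans _ (prod_dyadic_ge J)).
have e : N%:R * M%:R ^+ d = N%:R * (M%:R * M%:R ^+ d.-1) :> R.
  by rewrite -exprS prednK// (leq_trans _ d2).
rewrite e; apply: le_trans dn _.
rewrite -ler_pdivrMl ?exprn_gt0// -exprVn.
apply: le_trans P1 _; apply: le_trans chain _.
have hK : (1 - 2^-1 ^+ J) * K <= K.
  by rewrite ler_piMl// gerBl exprn_ge0//; lra.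
have hJ := ler_wpM2l (exprn_ge0 J (ler0n R 4)) du.
have hb := ler_wpM2l D0 bX.
apply: le_trans (lerD hJ hK) _.
have -> : K = D / c0 * (8 * M%:R ^+ d.+1) by rewrite /K; ring.
have -> : 4 ^+ J * (2 * (R1 + R1)%:R ^+ d * N%:R ^+ 2 + D * Y%:R ^+ d.+2 / c0 +
   D * (bj J)%:R ^+ d.+1 / c0) = 4 ^+ J * (2 * (R1 + R1)%:R ^+ d * N%:R ^+ 2) +
   D / c0 * (4 ^+ J * Y%:R ^+ d.+2) + D / c0 * (4 ^+ J * (bj J)%:R ^+ d.+1) by ring.
lra.
Qed.

End chain.

(** * Choice of the box *)

Section parameters.
Context {R : realType}.

Lemma ex_pow4 (g : R) : 1 <= g -> exists J : nat, g <= 4 ^+ J <= 4 * g.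
Proof.
move=> g1.
have ex : exists J : nat, g <= 4 ^+ J.
  exists (Num.truncn g).+1; apply: ltW; apply: lt_le_trans (truncnS_gt g) _.
  by rewrite -natrX ler_nat ltnW// ltn_expl.
case: (ex_minnP ex) => J gJ Jmin; exists J; rewrite gJ /=.
case: J gJ Jmin => [|J] gJ Jmin; first by rewrite expr0; lra.
rewrite exprS ler_pM2l// leNgt; apply/negP => /ltW /Jmin; lia.
Qed.

(** In the application u = 4^J and uY = X, while g = N^(1/(d^2+d-1)), so that u has
order g and Y has order g^d. *)
Lemma bound_from_count (d : nat) (N u Y g D k C C0 : R) : (1 < d)%N ->
  0 <= N -> 1 <= g -> g <= u <= 4 * g -> 1 <= C -> 
  C * g ^+ d <= Y <= 2 * C * g ^+ d ->
  2 * k * C0 <= C -> 0 <= k -> 0 <= D -> g ^+ (d ^ 2 + d - 1) = N ->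
  N * (u * Y) ^+ d <= k * (u * (C0 * N ^+ 2) + D * (u * Y ^+ d.+2 + 9 * (u * Y) ^+ d.+1)) ->
  N <= 2 * k * (76 * C ^+ 2) * D * g ^+ d.+1.
Proof.
move=> d1 N0 g1 /andP[gu ug] C1 /andP[CY YC] kC k0 D0 gN h.
have dE : d.-1.+1 = d by rewrite prednK// ltnW.
have eE : (d.-1 + d * d = d ^ 2 + d - 1)%N.
  by clear -d1 dE; rewrite expnS expn1; lia.
have g0 : 0 < g by lra.
have u0 : 0 < u by lra.
have gd1 : 1 <= g ^+ d by rewrite exprn_ege1.
have Y0 : 0 < Y by apply: lt_le_trans CY; nra.
have W0 : 0 < u ^+ d * Y ^+ d by rewrite mulr_gt0 ?exprn_gt0.
(* the choice of C makes the diagonal term at most half of the left-hand side *)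
have h1 : 2 * (k * (u * (C0 * N ^+ 2))) <= N * (u ^+ d * Y ^+ d).
  have Cd : C <= C ^+ d by rewrite -{1}(expr1 C) ler_weXn2l// ltnW.
  have e1 : g ^+ d.-1 * (C ^+ d * (g ^+ d) ^+ d) = C ^+ d * N.
    by rewrite -gN mulrCA -exprM -exprD eE.
  have e2 : C * N <= u ^+ d.-1 * Y ^+ d.
    apply: le_trans (_ : C ^+ d * N <= _); first by rewrite ler_wpM2r.
    rewrite -e1 -exprMn; apply: ler_pM; rewrite ?exprn_ge0 ?mulr_ge0 ?exprn_ge0//; try lra.
      by rewrite lerXn2r ?nnegrE//; lra.
    by rewrite lerXn2r ?nnegrE//; nra.
  have -> : u ^+ d = u * u ^+ d.-1 by rewrite -exprS dE.
  have e3 : 2 * k * C0 * N <= u ^+ d.-1 * Y ^+ d.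
    by apply: le_trans e2; rewrite ler_wpM2r.
  have := ler_wpM2l (mulr_ge0 N0 (ltW u0)) e3.
  by rewrite expr2; lra.
have h2 : u * Y ^+ d.+2 <= 4 * C ^+ 2 * g ^+ d.+1 * (u ^+ d * Y ^+ d).
  have -> : Y ^+ d.+2 = Y ^+ 2 * Y ^+ d by rewrite -exprD.
  rewrite mulrA [leRHS]mulrA ler_wpM2r ?exprn_ge0 ?(ltW Y0)//.
  have Y2 : Y ^+ 2 <= 4 * C ^+ 2 * (g ^+ d * g ^+ d) by rewrite expr2; nra.
  have -> : u ^+ d = u * u ^+ d.-1 by rewrite -exprS dE.
  have gd : g ^+ d = g * g ^+ d.-1 by rewrite -exprS dE.
  have gud : g ^+ d.-1 <= u ^+ d.-1 by rewrite lerXn2r ?nnegrE//; lra.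
  rewrite gd in Y2; rewrite [g ^+ d.+1]exprS gd.
  have p0 : 0 <= 4 * C ^+ 2 * (g * g) * u * g ^+ d.-1.
    by rewrite !mulr_ge0 ?exprn_ge0//; lra.
  have := ler_wpM2l (ltW u0) Y2; have := ler_wpM2l p0 gud.
  by move: (g ^+ d.-1) (u ^+ d.-1) => a b; lra.
have h3 : (u * Y) ^+ d.+1 <= 8 * C ^+ 2 * g ^+ d.+1 * (u ^+ d * Y ^+ d).
  rewrite exprS -exprMn ler_wpM2r ?exprn_ge0 ?mulr_ge0 ?(ltW u0) ?(ltW Y0)//.
  rewrite [g ^+ d.+1]exprS; have uY : u * Y <= 4 * g * (2 * C * g ^+ d) by apply: ler_pM; lra.
  apply: le_trans uY _.
  have CC : C <= C ^+ 2 by rewrite expr2; nra.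
  have gg : 0 <= g * g ^+ d by rewrite mulr_ge0 ?exprn_ge0 ?(ltW g0).
  have := ler_wpM2r gg CC; lra.
rewrite -(ler_pM2r W0).
rewrite exprMn in h.
have h4 := ler_wpM2l (mulr_ge0 k0 D0) h2.
have h5 := ler_wpM2l (mulr_ge0 k0 D0) h3.
move: h h1 h4 h5; rewrite !mulrDr; lra.
Qed.

End parameters.

(** * A lattice adapted to a direction *)

Section lattice.
Context {R : realType} {d : nat}.
Local Notation E := (euclid R d).
Variables (v : E) (i0 : 'I_d) (P : nat).
Implicit Types (nu : 'I_d -> int) (z : E) (n : d.-tuple int).
Hypotheses (v1 : dotp v v = 1) (v0 : tnth v i0 != 0) (P0 : (0 < P)%N).

(** [slope j] / P approximates v_j / v_i0; it makes the generators of the lattice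
below, other than the coordinate vector e_i0, nearly orthogonal to v. *)
Definition slope (j : 'I_d) : int := Num.floor (P%:R * tnth v j / tnth v i0).

(** nu_i0 e_i0 + sum_(j <> i0) nu_j (P e_j - slope_j e_i0) *)
Definition lattice_point nu : d.-tuple int :=
  [tuple if i == i0 then nu i0 - \sum_(j | j != i0) slope j * nu j else P%:Z * nu i | i < d].

(** The transpose of [lattice_point]: the coordinates of z against the generators. *)
Definition dual_point z (i : 'I_d) : R :=
  if i == i0 then tnth z i0 else P%:R * tnth z i - (slope i)%:~R * tnth z i0.

Lemma dotp_lattice_point nu z : dotp (intv (lattice_point nu)) z = \sum_i (nu i)%:~R * dual_point z i.
Proof.
rewrite /dotp (bigD1 i0)//= [RHS](bigD1 i0)//= !tnth_mktuple /dual_point eqxx.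
rewrite intrB mulrBl -addrA; congr (_ + _).
rewrite (_ : (\sum_(j | j != i0) slope j * nu j)%:~R * tnth z i0 =
  \sum_(j | j != i0) (slope j)%:~R * (nu j)%:~R * tnth z i0); last first.
  rewrite (raddf_sum (@intmul R 1)) mulr_suml; apply: eq_bigr => j _ /=.
  by rewrite intrM.
rewrite addrC -sumrB; apply: eq_bigr => j /negbTE ji.
by rewrite !tnth_mktuple ji intrM; ring.
Qed.

Lemma phase_lattice_point nu (N : nat) (z : 'I_N -> E) k :
  phase (lattice_point nu) (z k) = angle (fun k => dual_point (z k)) nu k.
Proof. by rewrite /phase /angle dotp_lattice_point. Qed.

Lemma lattice_point_inj nu nu' : lattice_point nu = lattice_point nu' -> nu =1 nu'.
Proof.
move=> e; have h j : j != i0 -> nu j = nu' j.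
  move=> ji; have := congr1 (fun t => tnth t j) e.
  rewrite !tnth_mktuple (negbTE ji); apply: mulfI.
  by rewrite eqz_nat -lt0n.
move=> j; case: (eqVneq j i0) => [->|]; last exact: h.
have := congr1 (fun t => tnth t i0) e.
rewrite !tnth_mktuple eqxx (eq_bigr (fun j => slope j * nu' j)); first exact: addIr.
by move=> k ki; rewrite h.
Qed.

Definition enorm (x : E) : R := Num.sqrt (dotp x x).

Lemma dotp_ge0 (x : E) : 0 <= dotp x x.
Proof. by apply: sumr_ge0 => i _; rewrite -expr2 sqr_ge0. Qed.

Lemma tnth_le_enorm (x : E) i : `|tnth x i| <= enorm x.
Proof.
rewrite -sqrtr_sqr ler_wsqrtr// expr2 /dotp (bigD1 i)//= lerDl.
by apply: sumr_ge0 => j _; rewrite -expr2 sqr_ge0.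
Qed.

Lemma enorm_le_sum (x : E) : enorm x <= \sum_i `|tnth x i|.
Proof.
have s0 : 0 <= \sum_i `|tnth x i| by exact: sumr_ge0.
rewrite -[leRHS]ger0_norm// -sqrtr_sqr ler_wsqrtr// expr2 mulr_suml /dotp.
apply: ler_sum => i _; rewrite -[leLHS]ger0_norm -?expr2 ?sqr_ge0// expr2 normrM.
by rewrite ler_wpM2l// (bigD1 i)//= lerDl sumr_ge0.
Qed.

(** A common bound for the comparison, in both directions, of the length of a
lattice point with the sup norm of its coordinates. *)
Definition distortion : nat := (1 + \sum_(j | j != i0) `|slope j| + d * P)%N.

Lemma sup_norm_attained nu : exists j, sup_norm nu = `|nu j|%N.
Proof.
have [|j jE] := @bigop.eq_bigmax 'I_d (fun i => `|nu i|%N); last by exists j.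
by rewrite card_ord (leq_ltn_trans _ (ltn_ord i0)).
Qed.

Let le_sup_norm nu j : `|(nu j)%:~R| <= (sup_norm nu)%:R :> R.
Proof. by rewrite -intr_norm -abszE -pmulrn ler_nat leq_sup_norm. Qed.

Lemma enorm_lattice_point_le nu : enorm (intv (lattice_point nu)) <= distortion%:R * (sup_norm nu)%:R.
Proof.
apply: le_trans (enorm_le_sum _) _.
rewrite (bigD1 i0)//= !tnth_mktuple eqxx /distortion natrD mulrDl; apply: lerD.
  rewrite natrD mulrDl mul1r intrB; apply: le_trans (ler_normB _ _) _; apply: lerD => //.
  rewrite (raddf_sum (@intmul R 1)) natr_sum mulr_suml.
  apply: le_trans (ler_norm_sum _ _ _) _; apply: ler_sum => j _ /=.
  rewrite intrM normrM ler_pM// -intr_norm -abszE -pmulrn //.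
rewrite natrM -mulrA -[X in X%:R]card_ord -sum1_card natr_sum mulr_suml.
rewrite [leLHS]big_mkcond; apply: ler_sum => j _; case: eqP => [_|ji].
  by rewrite /= mul1r mulr_ge0.
rewrite /= mul1r !tnth_mktuple ifF; last exact/eqP.
by rewrite intrM normrM -pmulrn normr_nat ler_wpM2l.
Qed.

Lemma sup_norm_le_enorm nu : (sup_norm nu)%:R <= distortion%:R * enorm (intv (lattice_point nu)).
Proof.
have n0 : 0 <= enorm (intv (lattice_point nu)) by exact: sqrtr_ge0.
have hj j : j != i0 -> `|(nu j)%:~R| <= enorm (intv (lattice_point nu)) :> R.
  move=> ji; apply: le_trans (tnth_le_enorm _ j).
  rewrite !tnth_mktuple (negbTE ji) intrM normrM ler_peMl//.
  by rewrite -[1]/(1%:R) ger0_norm// -pmulrn ler_nat.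
have hi : `|(nu i0)%:~R| <= (1 + \sum_(j | j != i0) `|slope j|)%:R * enorm (intv (lattice_point nu)) :> R.
  have -> : nu i0 = tnth (lattice_point nu) i0 + \sum_(j | j != i0) slope j * nu j.
    by rewrite tnth_mktuple eqxx subrK.
  rewrite intrD natrD mulrDl mul1r; apply: le_trans (ler_normD _ _) _; apply: lerD.
    by have := tnth_le_enorm (intv (lattice_point nu)) i0; rewrite tnth_mktuple.
  rewrite (raddf_sum (@intmul R 1)) natr_sum mulr_suml.
  apply: le_trans (ler_norm_sum _ _ _) _; apply: ler_sum => j ji /=.
  rewrite intrM normrM ler_pM ?hj// -intr_norm -abszE -pmulrn //.
have [j ->] := sup_norm_attained nu.
rewrite natr_absz intr_norm; case: (eqVneq j i0) => [->|ji].
  by apply: le_trans hi _; rewrite ler_wpM2r// ler_nat /distortion leq_addr.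
by apply: le_trans (hj j ji) _; rewrite ler_peMl// ler1n.
Qed.

(** Each generator has scalar product at most 1 with v, whereas the length of the
lattice point is at least P times the largest transversal coordinate, which off the
axis is the sup norm. *)
Lemma off_axis_lattice_point nu : off_axis i0 nu ->
  P%:R * `|dotp (intv (lattice_point nu)) v| <= d%:R * enorm (intv (lattice_point nu)).
Proof.
move=> /existsP[j /andP[ji hj]].
have dle i : `|dual_point v i| <= 1.
  have vle k : `|tnth v k| <= 1 by have := tnth_le_enorm v k; rewrite /enorm v1 sqrtr1.
  rewrite /dual_point; case: eqP => // _.
  have -> : P%:R * tnth v i - (slope i)%:~R * tnth v i0 =
     tnth v i0 * (P%:R * tnth v i / tnth v i0 - (slope i)%:~R) by field.
  rewrite normrM -[leRHS]mulr1 ler_pM// ger0_norm.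
    by have := floorD1_gt (P%:R * tnth v i / tnth v i0); rewrite -/(slope i) intrD; lra.
  by rewrite subr_ge0; exact: floor_le_tmp.
have h1 : `|dotp (intv (lattice_point nu)) v| <= d%:R * (sup_norm nu)%:R.
  rewrite dotp_lattice_point; apply: le_trans (ler_norm_sum _ _ _) _.
  rewrite -[X in X%:R]card_ord -sum1_card natr_sum mulr_suml; apply: ler_sum => i _.
  by rewrite normrM mulrC ler_pM.
have [k ki kE] : exists2 k, k != i0 & sup_norm nu = `|nu k|%N.
  have [k kE] := sup_norm_attained nu; case: (eqVneq k i0) => [ki|]; last by exists k.
  exists j => //; apply/eqP; rewrite eqn_leq leq_sup_norm andbT.
  by rewrite kE ki.
have h2 : P%:R * (sup_norm nu)%:R <= enorm (intv (lattice_point nu)) :> R.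
  apply: le_trans (tnth_le_enorm _ k).
  rewrite !tnth_mktuple (negbTE ki) intrM normrM -pmulrn normr_nat kE natr_absz intr_norm.
  by [].
apply: le_trans (ler_wpM2l (ler0n R P) h1) _.
by rewrite mulrCA ler_wpM2l.
Qed.

End lattice.

(** * Weights of the lattice frequencies *)

Section weights.
Context {R : realType} {d : nat}.
Local Notation E := (euclid R d).
Local Notation leb1 := (@lebesgue_measure R).
Variables (W : set E) (mW : measurable W) (Wc : W `<=` cube).
Variables (v : E) (i0 : 'I_d) (P : nat) (kappa beta A0 : R).
Hypotheses (v1 : dotp v v = 1) (v0 : tnth v i0 != 0) (P0 : (0 < P)%N).
Hypotheses (k0 : 0 < kappa) (Pb : d%:R <= P%:R * beta).
Hypothesis hyp : forall A : R, A0 < A -> forall Theta : E, sphere Theta ->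
  ((if `|dotp Theta v| <= beta
    then kappa / A ^+ (d + 1) else kappa / A ^+ (d + 2))%R%:E
   <= (A^-1)%R%:E * \int[leb1]_(rho in `[A, (2 * A)%R])
        (normc (fourier_indic W (scalev rho Theta)) ^+ 2)%R%:E)%E.

Local Notation B := (distortion v i0 P).

Let double_exprn (A T : R) (e : nat) : 0 <= A -> 2 * A <= T -> 2 * A ^+ e.+1 <= T ^+ e.+1.
Proof.
move=> A0' AT; rewrite !exprS mulrA; apply: ler_pM => //.
- by rewrite mulr_ge0.
- exact: exprn_ge0.
- by rewrite lerXn2r ?nnegrE//; lra.
Qed.

(** A is half of the length r of the lattice point, so that the average over
[A, 2A] corresponds to t in [1/2, 1]; the constants lost in comparing r with
the sup norm of nu are absorbed into the power of the distortion. *)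
Lemma weight_le (nu : 'I_d -> int) (R1 : nat) :
  2 * (`|A0| + 1) * B%:R <= R1%:R -> (R1 <= sup_norm nu)%N ->
  ((weight i0 (kappa / B%:R ^+ d.+2) nu)%:E <=
   \int[leb1]_(t in `[2^-1%R, 1%R]) (sqr_fourier W (lattice_point v i0 P nu) t)%:E)%E.
Proof.
move=> hR1 sR1.
have B1 : 1 <= B%:R :> R by rewrite ler1n.
set n := lattice_point v i0 P nu; set r := enorm (intv n : E); set s : R := (sup_norm nu)%:R.
have rs : r <= B%:R * s by exact: enorm_lattice_point_le.
have sr : s <= B%:R * r by exact: sup_norm_le_enorm.
have sR : R1%:R <= s by rewrite ler_nat.
have A00 : 0 <= `|A0| by [].
have r2 : 2 * (`|A0| + 1) <= r.
  rewrite -(ler_pM2r (_ : 0 < B%:R)); last lra.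
  by rewrite [r * _]mulrC; lra.
have r0 : 0 < r by lra.
have s0 : 0 < s by rewrite -(pmulr_rgt0 _ (_ : 0 < B%:R))//; lra.
have s1 : 1 <= s by rewrite ler1n -(ltr0n R).
pose A := r / 2; have rA : r = 2 * A by rewrite /A; field.
have A1 : A0 < A by have := ler_norm A0; rewrite /A; lra.
pose Theta : E := scalev r^-1 (intv n).
have sT : sphere Theta.
  rewrite /sphere /= /Theta dotpZl dotpZr mulrA -(sqr_sqrtr (dotp_ge0 _)).
  by rewrite -/(enorm _) -/r -expr2 -exprMn mulVf ?gt_eqF// expr1n sqrtr1.
have h := hyp A1 sT.
set c := (X in (X%:E <= _)%E) in h.
apply: le_trans (_ : ((c / 2)%:E <= _)%E); last first.
  exact: (le_average_sqr_fourier mW Wc r0 rA h).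
rewrite lee_fin.
have A0' : 0 <= A by rewrite /A; lra.
have AT : 2 * A <= B%:R * s by rewrite -rA.
have Bs1 : 1 <= B%:R * s by nra.
have B0 : 0 < B%:R :> R by lra.
have Bs0 e : 0 < (B%:R * s) ^+ e by rewrite exprn_gt0// mulr_gt0.
have hA e : kappa / (B%:R * s) ^+ e.+1 <= kappa / A ^+ e.+1 / 2.
  rewrite -mulrA ler_wpM2l ?(ltW k0)// -invfM.
  have Ae : 0 < A ^+ e.+1 by rewrite exprn_gt0// /A; lra.
  rewrite lef_pV2 ?posrE ?Bs0 ?mulr_gt0//.
  by rewrite mulrC; exact: double_exprn.
have wd : kappa / B%:R ^+ d.+2 / s ^+ d.+1 <= kappa / (B%:R * s) ^+ d.+1.
  rewrite -mulrA ler_wpM2l ?(ltW k0)// -invfM.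
  have p1 : 0 < B%:R ^+ d.+2 * s ^+ d.+1 by rewrite mulr_gt0// exprn_gt0.
  rewrite lef_pV2 ?posrE ?Bs0//.
  rewrite exprMn ler_wpM2r ?exprn_ge0 ?(ltW s0)// ler_weXn2l//.
have wd2 : kappa / B%:R ^+ d.+2 / s ^+ d.+2 = kappa / (B%:R * s) ^+ d.+2.
  by rewrite -mulrA -invfM -exprMn.
rewrite /weight /c addn1 addn2 -/s; case: (boolP (off_axis i0 nu)) => gn; last first.
  rewrite wd2; case: ifP => _; last exact: hA.
  apply: le_trans (hA d); rewrite ler_wpM2l ?(ltW k0)//.
  by rewrite lef_pV2 ?posrE ?Bs0// ler_weXn2l.
rewrite ifT; first exact: le_trans wd (hA d).
rewrite /Theta dotpZl normrM ger0_norm ?invr_ge0 ?(ltW r0)// mulrC ler_pdivrMr//.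
have := off_axis_lattice_point P v1 v0 gn; rewrite -/n -/r => hg.
rewrite -(ler_pM2l (_ : 0 < P%:R)) ?ltr0n//; apply: le_trans hg _.
by rewrite mulrA ler_wpM2r// ltW.
Qed.

Lemma freq_inj M : injective (fun F : {ffun 'I_d -> 'I_(M.*2.+1)} => freq F).
Proof.
move=> F F' e; apply/ffunP => i; apply/val_inj.
have /addIr[] := congr1 (fun f => f i) e; exact.
Qed.

Lemma weighted_energy_le (N M R1 : nat) (z : 'I_N -> E) : (forall j, cube (z j)) ->
  (0 < R1)%N -> 2 * (`|A0| + 1) * B%:R <= R1%:R ->
  ((4^-1 ^+ d * \sum_(F : {ffun 'I_d -> 'I_(M.*2.+1)} | (R1 <= sup_norm (freq F))%N)
      energy (fun k => dual_point v i0 P (z k)) (freq F) *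
      weight i0 (kappa / B%:R ^+ d.+2) (freq F))%:E <=
   \int[leb1]_(t in `]0%R, 1%R])
      \int[lebesgue R d]_(x in cube) (`|discrepancy W z x t| ^+ 2)%:E)%E.
Proof.
move=> cz R10 hR1.
pose S := [pred F : {ffun 'I_d -> 'I_(M.*2.+1)} | (R1 <= sup_norm (freq F))%N].
pose n (j : 'I_#|S|) := lattice_point v i0 P (freq (enum_val j)).
have n_inj : injective n.
  move=> j k /(lattice_point_inj P0) e; apply: enum_val_inj; apply: freq_inj.
  exact/funext.
have n0 j : exists i, tnth (n j) i != 0.
  have : (R1 <= sup_norm (freq (enum_val j)))%N by have := enum_valP j; rewrite inE.
  apply: contraTP => /forallNP h; rewrite -ltnNge; apply: leq_ltn_trans R10.
  apply/sup_norm_leP => i; rewrite leqn0 absz_eq0; apply/eqP.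
  have -> : freq (enum_val j) i = (fun=> 0 : int) i; last by [].
  apply: (lattice_point_inj (v := v) (i0 := i0) P0); apply: eq_from_tnth => l.
  have /negP := h l; rewrite negbK => /eqP ->; rewrite tnth_mktuple.
  case: ifP => _; last by rewrite mulr0.
  by rewrite big1 ?subr0// => k _; rewrite mulr0.
pose w (j : 'I_#|S|) := weight i0 (kappa / B%:R ^+ d.+2) (freq (enum_val j)).
have hw j : ((w j)%:E <= \int[leb1]_(t in `[2^-1%R, 1%R]) (sqr_fourier W (n j) t)%:E)%E.
  by apply: (weight_le hR1); have := enum_valP j; rewrite inE.
have := le_dilation_average mW Wc cz n_inj n0 hw.
rewrite (eq_bigl (mem S)) ?(big_enum_val (A := S)); last by move=> F; rewrite inE.
congr (_ <= _)%E; congr (_ * _)%:E; apply: eq_bigr => j _; congr (_ * _).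
by rewrite /energy /cos_sum /sin_sum; congr (_ ^+ 2 + _ ^+ 2); apply: eq_bigr => k _; rewrite phase_lattice_point.
Qed.

End weights.

(** * The lower bound for the discrepancy *)

Lemma ex_tnth_neq0 (R : realType) (d : nat) (v : euclid R d) : dotp v v = 1 ->
  exists i, tnth v i != 0.
Proof.
move=> v1; apply: contrapT => /forallNP h.
have : dotp v v = 0.
  by apply: big1 => i _; have /negP := h i; rewrite negbK => /eqP ->; rewrite mulr0.
by rewrite v1 => /eqP; rewrite oner_eq0.
Qed.

Theorem theorem1p2 (R : realType) (d : nat) (Omega : set (euclid R d)) :
  (2 <= d)%N ->
  measurable Omega ->
  Omega `<=` cube ->
  (exists (kappa1 beta1 : R) (v : euclid R d),
    [/\ 0 < kappa1, 0 < beta1, sphere v &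
      \forall A \near +oo, forall Theta : euclid R d, sphere Theta ->
        ((if `|dotp Theta v| <= beta1
          then kappa1 / A ^+ (d + 1) else kappa1 / A ^+ (d + 2))%R%:E
         <= (A^-1)%R%:E * \int[lebesgue_measure]_(rho in `[A, (2 * A)%R])
              (normc (fourier_indic Omega (scalev rho Theta)) ^+ 2)%R%:E)%E]) ->
  exists c : R, 0 < c /\
    \forall N \near \oo, forall z : 'I_N -> euclid R d,
      (forall j, cube (z j)) ->
      ((c * N%:R `^ (1 - (d%:R + 1) / (d%:R ^+ 2 + d%:R - 1)))%R%:E
       <= \int[lebesgue_measure]_(t in `]0%R, 1%R])
            \int[lebesgue R d]_(x in cube)
              (`|discrepancy Omega z x t| ^+ 2)%R%:E)%E.

Proof.
move=> d2 mO Oc [kappa [beta [v [k0 b0 sv [A0 [_ hyp]]]]]].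
have v1 : dotp v v = 1.
  by rewrite -[LHS](sqr_sqrtr (dotp_ge0 _)) [Num.sqrt _]sv expr1n.
have [i0 v0] := ex_tnth_neq0 v1.
pose P := (Num.truncn (d%:R / beta)).+1.
have P0 : (0 < P)%N by [].
have Pb : d%:R <= P%:R * beta :> R.
  by rewrite -ler_pdivrMr// ltW// truncnS_gt.
pose B := distortion v i0 P.
have B1 : 1 <= B%:R :> R by rewrite ler1n.
pose R1 := (Num.truncn (2 * (`|A0| + 1) * B%:R)).+1.
have hR1 : 2 * (`|A0| + 1) * B%:R <= R1%:R :> R by rewrite ltW// truncnS_gt.
pose c0 : R := kappa / B%:R ^+ d.+2.
have c00 : 0 < c0 by rewrite divr_gt0// exprn_gt0//; lra.
pose k : R := 4 ^+ d.-1.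
have k1 : 0 < k by rewrite exprn_gt0.
pose C0 : R := 2 * (R1 + R1)%:R ^+ d.
pose C : R := 2 * k * C0 + R1%:R.
have kC0 : 0 <= 2 * k * C0 by rewrite !mulr_ge0 ?(ltW k1)// exprn_ge0.
have R1C : R1%:R <= C by rewrite lerDr.
have C1 : 1 <= C by apply: le_trans R1C; rewrite ler1n.
have K0 : 0 < 2 * k * (76 * C ^+ 2) by rewrite !mulr_gt0//; lra.
exists (4^-1 ^+ d * (c0 / (2 * k * (76 * C ^+ 2)))); split.
  by apply: mulr_gt0; [rewrite exprn_gt0// invr_gt0|exact: divr_gt0].
exists 1%N => // N /= N1 z cz.
pose e : R := d%:R ^+ 2 + d%:R - 1.
have d1 : 1 <= d%:R :> R by rewrite ler1n ltnW.
have e0 : 0 < e by rewrite /e expr2; nra.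
have eE : (d ^ 2 + d - 1)%:R = e.
  by rewrite natrB ?natrD ?natrX// addn_gt0 (ltnW d2) orbT.
have NR1 : 1 <= N%:R :> R by rewrite ler1n.
pose g : R := N%:R `^ e^-1.
have g1 : 1 <= g.
  have : 1 `^ e^-1 <= g.
    by apply: ge0_ler_powR; rewrite ?nnegrE ?invr_ge0 ?(ltW e0).
  by rewrite powR1.
have gN : g ^+ (d ^ 2 + d - 1) = N%:R.
  by rewrite -powR_mulrn ?powR_ge0// -powRrM eE mulVf ?gt_eqF// powRr1.
have [J gJ] := ex_pow4 g1.
have Cg1 : 1 <= C * g ^+ d.
  by rewrite -[1]mulr1 ler_pM// exprn_ege1.
pose Y := (Num.truncn (C * g ^+ d)).+1.
have CgY : C * g ^+ d <= Y%:R <= 2 * C * g ^+ d.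
  rewrite ltW ?truncnS_gt//= /Y -addn1 natrD.
  have : (Num.truncn (C * g ^+ d))%:R <= C * g ^+ d by rewrite truncn_le; lra.
  lra.
have R1Y : (R1 <= Y)%N.
  rewrite -(ler_nat R); apply: le_trans R1C _; case/andP: CgY => CY _.
  by apply: le_trans CY; rewrite ler_peMr ?exprn_ege1//; lra.
pose M := (4 ^ J * Y)%N.
pose y k := dual_point v i0 P (z k).
pose D : R := \sum_(F : {ffun 'I_d -> 'I_(M.*2.+1)} | (R1 <= sup_norm (freq F))%N)
  energy y (freq F) * weight i0 c0 (freq F).
have R10 : (0 < R1)%N by [].
have count := anisotropic_count c00 R10 (lexx D) (erefl M) R1Y d2.
have D0 : 0 <= D := bound_ge0 c00 (lexx D).
have wt := weighted_energy_le mO Oc v1 v0 P0 k0 Pb hyp M cz R10 hR1.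
apply: (@le_trans _ _ (4^-1 ^+ d * D)%:E); last exact: wt.
rewrite lee_fin -[leLHS]mulrA; apply: ler_wpM2l; first by rewrite exprn_ge0.
have h : N%:R <= 2 * k * (76 * C ^+ 2) * (D / c0) * g ^+ d.+1.
  apply: (bound_from_count (u := 4 ^+ J) (Y := Y%:R) (C0 := C0) d2 _ g1 gJ C1 CgY _ (ltW k1) _ gN).
  - exact: ler0n.
  - by rewrite lerDl.
  - by rewrite divr_ge0// ltW.
  - by move: count; rewrite /M natrM natrX; rewrite -/k -/C0 mulrDr.
have g0 : 0 < g ^+ d.+1 by rewrite exprn_gt0// (lt_le_trans _ g1).
have -> : N%:R `^ (1 - (d%:R + 1) / (d%:R ^+ 2 + d%:R - 1)) = N%:R / g ^+ d.+1.
  rewrite powRB; last by apply/implyP => _; rewrite gt_eqF// ltr0n.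
  rewrite powRr1//; congr (_ / _).
  by rewrite -powR_mulrn ?powR_ge0// -powRrM mulrC -natr1.
rewrite [leLHS]mulrA ler_pdivrMr// -ler_pdivlMl; last by rewrite divr_gt0.
by apply: le_trans h _; rewrite le_eqVlt; apply/orP; left; apply/eqP; field; rewrite !gt_eqF//; lra.
Qed.
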